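(* Let $G$ be a finite group, $p$ a prime, $K\unlhd G$ a normal subgroup, $S\in \operatorname{Syl}_p(G)$, $T=K\cap S$, and let $M$ be a $\mathbb{Z}_{(p)}$-module with trivial $G$-action. Let $E_{*,G}$ be the Lyndon–Hochschild–Serre spectral sequence $$H^n(G/K;H^m(K;M))\Rightarrow H^{n+m}(G;M)$$ of the extension $K\to G\to G/K$, and let $E_*$ be the spectral sequence of $\mathcal{F}_S(G)$-stable elements $$H^n(S/T;H^m(T;M))^{\mathcal{F}_S(G)}\Rightarrow H^{n+m}(\mathcal{F}_S(G);M)$$ associated to the strongly $\mathcal{F}_S(G)$-closed subgroup $T$ of $S$. Then the spectral sequences $E_{*,G}$ and $E_*$ (from the second page on) are isomorphic.
   Context: $\mathcal{F}=\mathcal{F}_S(G)$ is the fusion system over $S$ whose objects are the subgroups of $S$ and whose morphisms are the homomorphisms $c_g|\colon P\to Q$ induced by conjugation by elements $g\in G$ with $gPg^{-1}\le Q$. The subgroup $T=K\cap S$ is a Sylow $p$-subgroup of $K$ and is strongly $\mathcal{F}$-closed, so each $\varphi\in\operatorname{Hom}_{\mathcal{F}}(P,Q)$ maps $P\cap T$ into $Q\cap T$. Put $H^*(\mathcal{F};M)=\{z\in H^*(S;M)\mid \operatorname{res}(z)=\varphi^*(z)\text{ for each }P\le S,\ \varphi\in\operatorname{Hom}_{\mathcal{F}}(P,S)\}$, which is isomorphic to $H^*(G;M)$. Construction of $E_*$: for $P\le S$ let $\{E_{k,P}^{*,*},d_k\}_{k\ge 2}$ be the Lyndon–Hochschild–Serre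 spectral sequence of $P\cap T\to P\to P/(P\cap T)$ with coefficients in $M$, so $E_{2,P}^{n,m}=H^n(P/(P\cap T);H^m(P\cap T;M))$. Each $\varphi\in\operatorname{Hom}_{\mathcal{F}}(P,Q)$ induces a morphism of spectral sequences $\varphi^*\colon E_{*,Q}\to E_{*,P}$. For $k\ge 2$ set $E_k^{n,m}=\{z\in E_{k,S}^{n,m}\mid \varphi^*(z)=(\iota_P^S)^*(z)\text{ for each }P\le S,\ \varphi\in\operatorname{Hom}_{\mathcal{F}}(P,S)\}$, where $\iota_P^S\colon P\to S$ is the inclusion, with differential the restriction of $d_k$. These form a spectral sequence $E_*$, a sub-spectral sequence of $E_{*,S}$, with second page $H^n(S/T;H^m(T;M))^{\mathcal{F}}$ and converging to $H^{n+m}(\mathcal{F};M)$. A morphism of spectral sequences is a sequence of morphisms of differential bigraded modules $f_k$ such that $f_{k+1}$ is induced by $f_k$ on cohomology. *)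

(* Defs.v *)
From HB Require Import structures.
From mathcomp Require Import all_boot all_order all_algebra all_fingroup all_solvable.
From mathcomp Require Import boolp functions.
From mathcomp Require Import zify.
Set Implicit Arguments.
Unset Strict Implicit.
Unset Printing Implicit Defensive.
Import Order.TTheory GRing.Theory Num.Theory.
Local Open Scope ring_scope.
Local Open Scope quotient_scope.

(* Z localized at the integers coprime to p; for p prime this is Z_(p), as
   subring of the rationals. *)
Definition Zloc_pred (p : nat) : {pred rat} :=
  fun x => coprime p `|denq x|%N.

Lemma Zloc_subring_closed p : subring_closed (Zloc_pred p).
Proof.
have den_dvd (a b : int) : b != 0 -> (`|denq (a%:Q / b%:Q)| %| `|b|)%N.
  by move=> b0; case: divqP b0 => [|k x k0 _]; rewrite ?eqxx // abszM dvdn_mull.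
have cop (a : int) (x y : rat) : x \in Zloc_pred p -> y \in Zloc_pred p ->
    forall z, z = a%:Q / (denq x * denq y)%:Q -> z \in Zloc_pred p.
  rewrite !unfold_in => cx cy z ->.
  have ne : denq x * denq y != 0 by rewrite mulf_neq0 ?denq_neq0.
  by apply: coprime_dvdr (den_dvd a _ ne) _; rewrite abszM coprimeMr cx.
split=> [|x y cx cy|x y cx cy]; first by rewrite unfold_in coprimen1.
- apply: (cop (numq x * denq y - numq y * denq x) x y cx cy).
  have dx : (denq x)%:Q != 0 by rewrite intr_eq0 denq_neq0.
  have dy : (denq y)%:Q != 0 by rewrite intr_eq0 denq_neq0.
  rewrite -{1}[x]divq_num_den -{1}[y]divq_num_den rmorphB !rmorphM /=.
  by rewrite -[in LHS]mulNr addf_div // mulNr.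
- apply: (cop (numq x * numq y) x y cx cy).
  by rewrite -{1}[x]divq_num_den -{1}[y]divq_num_den mulf_div !rmorphM.
Qed.

HB.instance Definition _ p :=
  GRing.isSubringClosed.Build rat (Zloc_pred p) (Zloc_subring_closed p).

Definition Zloc (p : nat) := {x : rat | x \in Zloc_pred p}.
HB.instance Definition _ p := SubChoice.on (Zloc p).
HB.instance Definition _ p :=
  [SubChoice_isSubComNzRing of Zloc p by <:].

Section SubQuotient.
Variables (R : pzRingType) (V : lmodType R).

(* subquot Z B is the module Z / (Z :&: B), for submodules Z and B of V. *)
Definition submod_of (Z : submodClosed V) := {x : V | x \in Z}.
HB.instance Definition _ Z := SubChoice.on (submod_of Z).
HB.instance Definition _ Z := [SubChoice_isSubLmodule of submod_of Z by <:].

Variables Z B : submodClosed V.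

Definition in_den : {pred submod_of Z} := fun x => val x \in B.

Lemma in_denE x : (x \in in_den) = (val x \in B). Proof. by []. Qed.

Lemma in_den_zmod_closed : zmod_closed in_den.
Proof.
split=> [|x y]; rewrite !in_denE ?raddf0 ?rpred0 // => xB yB. rewrite raddfB.
exact: (GRing.submod_closedB (submodClosedP B)).2.
Qed.
HB.instance Definition _ :=
  GRing.isZmodClosed.Build (submod_of Z) in_den in_den_zmod_closed.

Definition subquot := Quotient.quot (in_den : zmodClosed (submod_of Z)).
HB.instance Definition _ := GRing.Zmodule.on subquot.
HB.instance Definition _ := EqQuotient.on subquot.

Definition sqpi (x : submod_of Z) : subquot := \pi_subquot x.

Lemma sqpi_surj u : exists x, u = sqpi x.
Proof. by exists (generic_quotient.repr u); rewrite /sqpi reprK. Qed.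

Lemma sqpiE x y : (sqpi x = sqpi y) <-> (x - y \in in_den).
Proof. by rewrite Quotient.idealrBE; split=> /eqP. Qed.

Lemma sqpiD x y : sqpi (x + y) = sqpi x + sqpi y.
Proof. exact: pi_addr. Qed.

Definition sqscale (c : R) (u : subquot) : subquot :=
  sqpi (c *: generic_quotient.repr u).

Lemma sqscale_pi c x : sqscale c (sqpi x) = sqpi (c *: x).
Proof.
apply/sqpiE; rewrite -scalerBr in_denE linearZ rpredZ //.
by rewrite -in_denE; apply/sqpiE; rewrite /sqpi reprK.
Qed.

Fact sqscaleA a b u : sqscale a (sqscale b u) = sqscale (a * b) u.
Proof. by have [x ->] := sqpi_surj u; rewrite !sqscale_pi scalerA. Qed.
Fact sqscale1 : left_id 1 sqscale.
Proof. by move=> u; have [x ->] := sqpi_surj u; rewrite sqscale_pi scale1r. Qed.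
Fact sqscaleDr : right_distributive sqscale +%R.
Proof.
move=> a u v; have [x ->] := sqpi_surj u; have [y ->] := sqpi_surj v.
by rewrite -sqpiD !sqscale_pi scalerDr sqpiD.
Qed.
Fact sqscaleDl u : {morph sqscale^~ u : a b / a + b}.
Proof.
by move=> a b; have [x ->] := sqpi_surj u; rewrite !sqscale_pi scalerDl sqpiD.
Qed.
HB.instance Definition _ := GRing.Zmodule_isLmodule.Build R subquot
  sqscaleA sqscale1 sqscaleDr sqscaleDl.

(* The class of x in subquot Z B; only meaningful for x in Z. *)
Definition sqclass (x : V) : subquot := sqpi (insubd 0 x).

Lemma sqclassE x y : x \in Z -> y \in Z ->
  (sqclass x = sqclass y) <-> (x - y \in B).
Proof.
by move=> xZ yZ; apply: iff_trans (sqpiE _ _) _; rewrite in_denE raddfB /= !insubdK.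
Qed.

Lemma sqclassP c x y : x \in Z -> y \in Z ->
  sqclass (c *: x + y) = c *: sqclass x + sqclass y.
Proof.
move=> xZ yZ; rewrite [c *: sqclass x]sqscale_pi -sqpiD; congr sqpi.
by apply: val_inj; rewrite linearP /= !insubdK // rpredD ?rpredZ.
Qed.

Lemma sqclass_surj (u : subquot) : exists2 x, x \in Z & u = sqclass x.
Proof.
have [x ->] := sqpi_surj u; exists (val x); first exact: valP.
by rewrite /sqclass valKd.
Qed.

Lemma sqclass0 x : x \in Z -> (sqclass x = 0) <-> (x \in B).
Proof.
have -> : 0 = sqclass 0 :> subquot.
  have -> : sqclass 0 = sqpi 0.
    by congr sqpi; apply: val_inj; rewrite insubdK ?rpred0.
  by apply: (addrI (sqpi 0)); rewrite -sqpiD !addr0.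
by move=> xZ; rewrite -[X in X \in B]subr0; apply: sqclassE; rewrite ?rpred0.
Qed.
End SubQuotient.

Section SubQuotientMap.
Variables (R : pzRingType) (V W : lmodType R).
Variables (Z B : submodClosed V) (Z' B' : submodClosed W).
Variable h : {linear V -> W}.

(* The map induced on subquotients by a linear map h. *)
Definition sqmap of {in Z, forall x, h x \in Z'} & {in B, forall x, h x \in B'} :=
  fun u : subquot Z B =>
    sqclass Z' B' (h (val (generic_quotient.repr u))).

Hypotheses (hZ : {in Z, forall x, h x \in Z'}).
Hypotheses (hB : {in B, forall x, h x \in B'}).

Lemma sqmapE x : x \in Z -> sqmap hZ hB (sqclass Z B x) = sqclass Z' B' (h x).
Proof.
move=> xZ; rewrite /sqmap; set y := generic_quotient.repr _.
have yZ : val y \in Z by apply: valP.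
apply/sqclassE; rewrite ?hZ // -raddfB; apply: hB.
by apply/(sqclassE _ yZ xZ); rewrite -[RHS]reprK /sqclass valKd.
Qed.

Lemma sqmap_is_linear : linear (sqmap hZ hB).
Proof.
move=> c u v; have [x xZ ->] := sqclass_surj u.
have [y yZ ->] := sqclass_surj v.
by rewrite -sqclassP // !sqmapE ?rpredD ?rpredZ // linearP sqclassP ?hZ.
Qed.
HB.instance Definition _ :=
  GRing.isLinear.Build R (subquot Z B) (subquot Z' B') _ (sqmap hZ hB)
    sqmap_is_linear.
End SubQuotientMap.

(* Pages and differentials are given for all k, but only k >= 2 is ever used.
   ss_next z u reads: z is a d_k-cycle, and the homology class of z corresponds
   to u under the identification H(E_k, d_k) = E_{k+1}. *)
Record ss_data (R : pzRingType) := SSData {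
  ss_page : nat -> int -> int -> lmodType R;
  ss_d : forall k n m,
    {linear ss_page k n m -> ss_page k (n + k%:Z) (m - k%:Z + 1)};
  ss_next : forall k n m, ss_page k n m -> ss_page k.+1 n m -> Prop
}.

Arguments ss_d {R s k n m}.
Arguments ss_next {R s k n m}.

(* d_k d_k = 0, and ss_next is the graph of a linear surjection from ker d_k to
   E_{k+1} with kernel im d_k. *)
Definition is_spectral_sequence (R : pzRingType) (E : ss_data R) : Prop :=
  forall k n m, (2 <= k)%N ->
  [/\ forall z : ss_page E k n m, ss_d (ss_d z) = 0,
      forall z : ss_page E k n m, ss_d z = 0 <-> exists u, ss_next z u,
      forall (z : ss_page E k n m) u u', ss_next z u -> ss_next z u' -> u = u',
      forall u : ss_page E k.+1 n m, exists z : ss_page E k n m, ss_next z u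
    & (forall c (z z' : ss_page E k n m) u u',
         ss_next z u -> ss_next z' u' ->
         ss_next (c *: z + z') (c *: u + u')) /\
      (forall z : ss_page E k (n + k%:Z) (m - k%:Z + 1),
         ss_next z 0 <-> exists y : ss_page E k n m, z = ss_d y)].

Definition ss_family (R : pzRingType) (E E' : ss_data R) :=
  forall k n m, {linear ss_page E k n m -> ss_page E' k n m}.

(* The last clause says that f_{k+1} is induced by f_k on homology. *)
Definition ss_morphism (R : pzRingType) (E E' : ss_data R)
    (f : ss_family E E') : Prop :=
  forall k n m, (2 <= k)%N ->
  (forall z : ss_page E k n m, f _ _ _ (ss_d z) = ss_d (f _ _ _ z)) /\
  (forall (z : ss_page E k n m) u, ss_next z u ->
     ss_next (f _ _ _ z) (f _ _ _ u)).

Definition ss_isomorphic (R : pzRingType) (E E' : ss_data R) : Prop :=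
  exists (f : ss_family E E') (g : ss_family E' E),
  [/\ ss_morphism f, ss_morphism g
    & forall k n m, (2 <= k)%N ->
        cancel (f k n m) (g k n m) /\ cancel (g k n m) (f k n m)].

Lemma ss_isomorphic_is_ss (R : pzRingType) (E E' : ss_data R) :
  ss_isomorphic E E' -> is_spectral_sequence E -> is_spectral_sequence E'.
Proof.
move=> [f [g [mf mg fg]]] ssE k n m k2.
have k2' := leqW k2.
have [dd cyc fnc sur [lin bou]] := ssE k n m k2.
split; last split.
- move=> z; rewrite -[z](fg _ _ _ k2).2 -(mf _ _ _ k2).1 -(mf _ _ _ k2).1.
  by rewrite dd linear0.
- move=> z; split=> [dz|[u zu]].
    have [|u gzu] := (cyc (g k n m z)).1; first by rewrite -(mg _ _ _ k2).1 dz linear0.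
    exists (f _ _ _ u); rewrite -[z](fg _ _ _ k2).2.
    exact: (mf _ _ _ k2).2.
  have dgz : ss_d (g _ _ _ z) = 0 by apply/cyc; exists (g _ _ _ u); apply: (mg _ _ _ k2).2.
  by rewrite -[z](fg _ _ _ k2).2 -(mf _ _ _ k2).1 dgz linear0.
- move=> z u u' zu zu'; rewrite -[u](fg _ _ _ k2').2 -[u'](fg _ _ _ k2').2.
  by congr (f _ _ _ _); apply: fnc; apply: (mg _ _ _ k2).2; eassumption.
- move=> u; have [z zu] := sur (g _ _ _ u); exists (f _ _ _ z).
  by rewrite -[u](fg _ _ _ k2').2; apply: (mf _ _ _ k2).2.
- move=> c z z' u u' zu zu'.
  rewrite -[c *: z + z'](fg _ _ _ k2).2 -[c *: u + u'](fg _ _ _ k2').2.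
  apply: (mf _ _ _ k2).2; rewrite !linearP; apply: lin; exact: (mg _ _ _ k2).2.
- move=> z; split=> [z0|[y ->]].
    have [|y gy] := (bou (g _ _ _ z)).1.
      by rewrite -(linear0 (g k.+1 _ _)); apply: (mg _ _ _ k2).2.
    by exists (f _ _ _ y); rewrite -(mf _ _ _ k2).1 -gy (fg _ _ _ k2).2.
  rewrite -(linear0 (f k.+1 _ _)) -[y](fg _ _ _ k2).2 -(mf _ _ _ k2).1.
  by apply: (mf _ _ _ k2).2; apply/bou; exists (g _ _ _ y).
Qed.

(* A cochain complex with a decreasing filtration, where fc_fil n t stands for
   F^n C^t, all realized inside one ambient module. *)
Record filtered_complex (R : pzRingType) := FilteredComplex {
  fc_mod : lmodType R;
  fc_d : {linear fc_mod -> fc_mod};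
  fc_fil : int -> int -> submodClosed fc_mod;
  fc_fil_decr : forall n t x, x \in fc_fil (n + 1) t -> x \in fc_fil n t;
  fc_fil_d : forall n t x, x \in fc_fil n t -> fc_d x \in fc_fil n (t + 1);
  fc_dd : forall n t x, x \in fc_fil n t -> fc_d (fc_d x) = 0
}.

Section FilteredComplex.
Variables (R : pzRingType) (C : filtered_complex R).
Implicit Types (k : nat) (n m t : int) (x y : fc_mod C).

(* Z_k^n = { x in F^n C^t | d x in F^(n+k) C^(t+1) } *)
Definition cycle_pred k n t : {pred fc_mod C} :=
  fun x => (x \in fc_fil C n t) && (fc_d C x \in fc_fil C (n + k%:Z) (t + 1)).

Lemma cycle_pred_closed k n t : submod_closed (cycle_pred k n t).
Proof.
split=> [|c x y /andP[xF dxF] /andP[yF dyF]].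
  by rewrite unfold_in linear0 !rpred0.
by apply/andP; split; rewrite ?linearP rpredD ?rpredZ.
Qed.
HB.instance Definition _ k n t :=
  GRing.isSubmodClosed.Build R (fc_mod C) (cycle_pred k n t)
    (cycle_pred_closed k n t).
Definition fc_Z k n t : submodClosed (fc_mod C) := cycle_pred k n t.

(* B_k^n = Z_(k-1)^(n+1) + d Z_(k-1)^(n-k+1), in total degree t *)
Definition boundary_pred k n t : {pred fc_mod C} :=
  fun x => `[< exists y w, [/\ y \in fc_Z k.-1 (n + 1) t,
                 w \in fc_Z k.-1 (n - k%:Z + 1) (t - 1) & x = y + fc_d C w] >].

Lemma boundary_pred_closed k n t : submod_closed (boundary_pred k n t).
Proof.
split=> [|c x y /asboolP[x1 [x2 [h1 h2 ->]]] /asboolP[y1 [y2 [h3 h4 ->]]]].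
  by apply/asboolP; exists 0, 0; rewrite !rpred0 linear0 addr0.
apply/asboolP; exists (c *: x1 + y1), (c *: x2 + y2).
by rewrite !rpredD ?rpredZ // linearP scalerDr addrACA.
Qed.
HB.instance Definition _ k n t :=
  GRing.isSubmodClosed.Build R (fc_mod C) (boundary_pred k n t)
    (boundary_pred_closed k n t).
Definition fc_B k n t : submodClosed (fc_mod C) := boundary_pred k n t.

Lemma fc_ZP k n t x : reflect
  (x \in fc_fil C n t /\ fc_d C x \in fc_fil C (n + k%:Z) (t + 1)) (x \in fc_Z k n t).
Proof. exact: andP. Qed.

Lemma fc_BP k n t x : reflect
  (exists y w, [/\ y \in fc_Z k.-1 (n + 1) t,
     w \in fc_Z k.-1 (n - k%:Z + 1) (t - 1) & x = y + fc_d C w])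
  (x \in fc_B k n t).
Proof. exact: asboolP. Qed.

Definition fc_page k n m : lmodType R := subquot (fc_Z k n (n + m)) (fc_B k n (n + m)).

Lemma fc_deg k n m : n + k%:Z + (m - k%:Z + 1) = n + m + 1.
Proof. by rewrite [m - _ + 1]addrAC addrACA subrr addr0 addrA. Qed.

Lemma fc_d_Z k n m : {in fc_Z k n (n + m), forall x,
  fc_d C x \in fc_Z k (n + k%:Z) (n + k%:Z + (m - k%:Z + 1))}.
Proof.
move=> x /fc_ZP[xF dxF]; apply/fc_ZP; rewrite fc_deg; split=> //.
by rewrite (fc_dd xF) rpred0.
Qed.

Lemma fc_d_B k n m : {in fc_B k n (n + m), forall x,
  fc_d C x \in fc_B k (n + k%:Z) (n + k%:Z + (m - k%:Z + 1))}.
Proof.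
move=> x /fc_BP[y [w [yZ /fc_ZP[wF _] ->]]]; apply/fc_BP; exists 0, y.
by rewrite fc_deg !addrK rpred0 linearD (fc_dd wF) addr0 add0r.
Qed.

Definition fc_diff k n m :
    {linear fc_page k n m -> fc_page k (n + k%:Z) (m - k%:Z + 1)} :=
  sqmap (@fc_d_Z k n m) (@fc_d_B k n m).

Definition fc_next k n m (z : fc_page k n m) (u : fc_page k.+1 n m) : Prop :=
  exists x, [/\ x \in fc_Z k.+1 n (n + m),
    z = sqclass (fc_Z k n (n + m)) (fc_B k n (n + m)) x
    & u = sqclass (fc_Z k.+1 n (n + m)) (fc_B k.+1 n (n + m)) x].

Definition fc_ss : ss_data R := SSData fc_diff fc_next.

Lemma fc_Z_succ k n t x : x \in fc_Z k.+1 n t -> x \in fc_Z k n t.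
Proof.
move=> /fc_ZP[xF dxF]; apply/fc_ZP; split=> //; apply: fc_fil_decr.
by rewrite -addrA -PoszD addn1.
Qed.

Lemma fc_Z_fil k n t x : x \in fc_Z k.+1 n t -> fc_d C x \in fc_Z k (n + k.+1%:Z) (t + 1).
Proof. by move=> /fc_ZP[xF dxF]; apply/fc_ZP; rewrite (fc_dd xF) rpred0. Qed.

Lemma fc_ZB k n t x : (0 < k)%N -> x \in fc_Z k.-1 (n + 1) t -> x \in fc_B k n t.
Proof. by move=> k0 xZ; apply/fc_BP; exists x, 0; rewrite rpred0 linear0 addr0. Qed.

Lemma fc_Z_pred k n t x : (0 < k)%N -> x \in fc_Z k.-1 (n + 1) t -> x \in fc_Z k n t.
Proof.
case: k => // k _ /fc_ZP[xF dxF]; apply/fc_ZP; split; first exact: fc_fil_decr.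
by rewrite -add1n PoszD addrA.
Qed.

Lemma fc_BZ k n t x : (0 < k)%N -> x \in fc_B k n t -> x \in fc_Z k n t.
Proof.
case: k => // k k0 /fc_BP[y [w [yZ /fc_ZP[wF dwF] ->]]].
apply: rpredD; first exact: fc_Z_pred.
apply/fc_ZP; rewrite (fc_dd wF) rpred0; split=> //.
suff -> : n = n - k.+1%:Z + 1 + k%:Z by move: dwF; rewrite subrK.
by lia.
Qed.

Lemma fc_deg2 k n : n + k%:Z - k.+1%:Z + 1 = n.
Proof. by rewrite -[k.+1]addn1 PoszD opprD addrA !addrK. Qed.

Theorem fc_ss_spectral_sequence : is_spectral_sequence fc_ss.
Proof.
move=> [//|k] n m k2; split; last split.
- move=> z; have [x xZ ->] := sqclass_surj z.
  rewrite /= !sqmapE ?fc_d_Z //; apply/sqclass0; first by do 2![apply: fc_d_Z].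
  by have /fc_ZP[xF _] := xZ; rewrite (fc_dd xF) rpred0.
- move=> z; split=> [|[u [x [xZ -> _]]]]; last first.
    have xZ' := fc_Z_succ xZ.
    rewrite /= sqmapE //; apply/sqclass0; first exact: fc_d_Z.
    apply: fc_ZB => //; rewrite fc_deg -addrA -PoszD addn1.
    apply: fc_Z_succ; exact: fc_Z_fil.
  have [x xZ ->] := sqclass_surj z; rewrite /= sqmapE //.
  move/sqclass0 => /(_ (fc_d_Z xZ))/fc_BP[y [w []]].
  rewrite fc_deg !addrK => yZ wZ dx.
  have wZ' := fc_Z_pred (isT : (0 < k.+1)%N) wZ.
  have xwZ : x - w \in fc_Z k.+2 n (n + m).
    have [/fc_ZP[xF _] /fc_ZP[wF _] /fc_ZP[yF _]] := And3 xZ wZ' yZ.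
    apply/fc_ZP; rewrite linearB dx addrK /= -addn1 PoszD addrA; split=> //.
    by rewrite -scaleN1r rpredD ?rpredZ.
  exists (sqclass _ _ (x - w)), (x - w); split=> //.
  have xwZ' := fc_Z_succ xwZ.
  by apply/sqclassE => //; rewrite opprB addrCA subrr addr0 fc_ZB.
- move=> z u u' [x [xZ -> ->]] [x' [xZ' + ->]].
  move/sqclassE => /(_ (fc_Z_succ xZ) (fc_Z_succ xZ'))/fc_BP[y [w [yZ wZ e]]].
  apply/sqclassE => //; apply/fc_BP; exists y, w; split=> //.
    have [/fc_ZP[yF _] /fc_ZP[wF _]] := (yZ, wZ).
    have dy : fc_d C y = fc_d C (x - x') by rewrite e linearD (fc_dd wF) addr0.
    have [/fc_ZP[_ dxF] /fc_ZP[_ dxF']] := (xZ, xZ').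
    apply/fc_ZP; split=> //; rewrite dy linearB -scaleN1r -addrA -PoszD add1n.
    by rewrite rpredD ?rpredZ.
  apply: fc_Z_pred => //; rewrite (_ : n - _ + 1 + 1 = n - k.+1%:Z + 1) //.
  by rewrite -[k.+2]addn1 PoszD opprD addrA subrK.
- move=> u; have [x xZ ->] := sqclass_surj u.
  by exists (sqclass _ _ x), x.
- move=> c z z' u u' [x [xZ -> ->]] [x' [xZ' -> ->]]; exists (c *: x + x').
  have [xZ1 xZ1'] := (fc_Z_succ xZ, fc_Z_succ xZ').
  by rewrite rpredD ?rpredZ // !sqclassP.
- move=> z; split=> [[x [xZ -> /esym]]|[y ->]].
    move/sqclass0 => /(_ xZ)/fc_BP[y [w [yZ wZ xE]]].
    have wZ' : w \in fc_Z k.+1 n (n + m).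
      by move: wZ; rewrite fc_deg addrK fc_deg2.
    exists (sqclass _ _ w); rewrite /= sqmapE //.
    apply/sqclassE; [exact: fc_Z_succ | exact: fc_d_Z |].
    rewrite xE addrK.
    by apply: fc_ZB => //; apply: fc_Z_succ.
  have [w wZ ->] := sqclass_surj y; rewrite /= sqmapE //; exists (fc_d C w).
  have dwZ : fc_d C w \in fc_Z k.+2 (n + k.+1%:Z) (n + k.+1%:Z + (m - k.+1%:Z + 1)).
    have /fc_ZP[wF dwF] := wZ.
    by apply/fc_ZP; rewrite fc_deg (fc_dd wF) rpred0.
  split=> //; apply/esym/sqclass0 => //; apply/fc_BP; exists 0, w.
  by rewrite rpred0 add0r fc_deg addrK fc_deg2.
Qed.
End FilteredComplex.

Record fc_morphism (R : pzRingType) (C D : filtered_complex R) := FcMorphism {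
  fm_fun :> {linear fc_mod C -> fc_mod D};
  fm_fil : forall n t x, x \in fc_fil C n t -> fm_fun x \in fc_fil D n t;
  fm_d : forall n t x, x \in fc_fil C n t ->
    fm_fun (fc_d C x) = fc_d D (fm_fun x)
}.

Section FcMorphism.
Variables (R : pzRingType) (C D : filtered_complex R) (h : fc_morphism C D).

Lemma fm_Z k n t : {in fc_Z C k n t, forall x, h x \in fc_Z D k n t}.
Proof.
move=> x /fc_ZP[xF dxF]; apply/fc_ZP.
by rewrite -(fm_d h xF) !fm_fil.
Qed.

Lemma fm_B k n t : {in fc_B C k n t, forall x, h x \in fc_B D k n t}.
Proof.
move=> x /fc_BP[y [w [yZ wZ ->]]]; apply/fc_BP; exists (h y), (h w).
have /fc_ZP[wF _] := wZ.
by rewrite !fm_Z // linearD (fm_d h wF).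
Qed.

Definition fm_page k n m : {linear fc_page C k n m -> fc_page D k n m} :=
  sqmap (@fm_Z k n (n + m)) (@fm_B k n (n + m)).

Lemma fm_page_d k n m (z : fc_page C k n m) :
  fm_page _ _ _ (fc_diff C k n m z) = fc_diff D k n m (fm_page _ _ _ z).
Proof.
have [x xZ ->] := sqclass_surj z.
rewrite /= !sqmapE ?fc_d_Z ?fm_Z //; have /fc_ZP[xF _] := xZ.
by rewrite (fm_d h xF).
Qed.
End FcMorphism.

Section Equalizer.
Variables (R : pzRingType) (C : filtered_complex R) (I : Type).
Variables (D : I -> filtered_complex R) (f g : forall i, fc_morphism C (D i)).

(* The elements of the pages of C on which the maps induced by f i and g i agree
   for all i, with the restrictions of the differentials of C and of its
   identifications H(E_k) = E_{k+1}. *)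
Definition eq_pred k n m : {pred fc_page C k n m} :=
  fun z => `[< forall i, fm_page (f i) k n m z = fm_page (g i) k n m z >].

Lemma eq_predP k n m (z : fc_page C k n m) : reflect
  (forall i, fm_page (f i) k n m z = fm_page (g i) k n m z) (z \in @eq_pred k n m).
Proof. exact: asboolP. Qed.

Lemma eq_pred_closed k n m : submod_closed (@eq_pred k n m).
Proof.
split=> [|c x y /eq_predP xE /eq_predP yE]; apply/eq_predP => i.
  by rewrite !linear0.
by rewrite !linearP xE yE.
Qed.
HB.instance Definition _ k n m :=
  GRing.isSubmodClosed.Build R (fc_page C k n m) (@eq_pred k n m)
    (@eq_pred_closed k n m).

Definition eq_page k n m : lmodType R :=
  submod_of (@eq_pred k n m : submodClosed (fc_page C k n m)).

Lemma eq_diff_subproof k n m (z : eq_page k n m) :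
  fc_diff C k n m (val z) \in @eq_pred k (n + k%:Z) (m - k%:Z + 1).
Proof.
apply/eq_predP => i; rewrite !fm_page_d.
by congr (fc_diff _ _ _ _ _); apply/eq_predP/(valP z).
Qed.

Definition eq_diff_fun k n m (z : eq_page k n m) :
    eq_page k (n + k%:Z) (m - k%:Z + 1) :=
  Sub (fc_diff C k n m (val z)) (eq_diff_subproof z).

Lemma eq_diff_is_linear k n m : linear (@eq_diff_fun k n m).
Proof. by move=> c x y; apply: val_inj; rewrite /= !linearP. Qed.
HB.instance Definition _ k n m :=
  GRing.isLinear.Build R (eq_page k n m) (eq_page k (n + k%:Z) (m - k%:Z + 1))
    _ (@eq_diff_fun k n m) (@eq_diff_is_linear k n m).

Definition eq_diff k n m :
  {linear eq_page k n m -> eq_page k (n + k%:Z) (m - k%:Z + 1)} :=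
  @eq_diff_fun k n m.

Definition eq_ss : ss_data R :=
  SSData eq_diff (fun k n m z u => fc_next (val z) (val u)).
End Equalizer.

Section Coface.
Variables (R : pzRingType) (M : lmodType R).

(* s with its i-th entry removed *)
Definition del (T : Type) (i : nat) (s : seq T) : seq T :=
  take i s ++ drop i.+1 s.

Definition coface (T : Type) (g : seq T -> M) (s : seq T) : M :=
  \sum_(i < size s) (-1 : R) ^+ i *: g (del i s).

Lemma coface_cons T (g : seq T -> M) x s :
  coface g (x :: s) = g s - coface (fun r => g (x :: r)) s.
Proof.
rewrite /coface big_ord_recl /= expr0 scale1r /del /= drop0; congr (_ + _).
rewrite -sumrN; apply: eq_bigr => i _.
by rewrite exprS mulN1r scaleNr.
Qed.

Lemma cofaceD T (g g' : seq T -> M) s :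
  coface (fun r => g r + g' r) s = coface g s + coface g' s.
Proof. by rewrite -big_split /=; apply: eq_bigr => i _; rewrite scalerDr. Qed.

Lemma cofaceZ T c (g : seq T -> M) s :
  coface (fun r => c *: g r) s = c *: coface g s.
Proof.
rewrite scaler_sumr; apply: eq_bigr => i _.
by rewrite !scalerA commr_sign.
Qed.

Lemma eq_coface T (g g' : seq T -> M) s :
  (forall i, (i < size s)%N -> g (del i s) = g' (del i s)) ->
  coface g s = coface g' s.
Proof. by move=> e; apply: eq_bigr => i _; rewrite e. Qed.

Lemma coface0 T (g : seq T -> M) s :
  (forall i, (i < size s)%N -> g (del i s) = 0) -> coface g s = 0.
Proof. by move=> e; apply: big1 => i _; rewrite e ?scaler0. Qed.

Lemma coface_coface T (g : seq T -> M) s : coface (coface g) s = 0.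
Proof.
elim: s g => [|x s IH] g; first by rewrite /coface big_ord0.
rewrite coface_cons.
rewrite (eq_coface (g := fun r => coface g (x :: r))
  (g' := fun r => g r + -1 *: coface (fun q => g (x :: q)) r)).
  by rewrite cofaceD cofaceZ IH scaler0 addr0 subrr.
by move=> i _; rewrite coface_cons scaleN1r.
Qed.

Lemma coface_comm T U (g : seq T -> seq U -> M) s t :
  coface (fun s' => coface (g s') t) s = coface (fun t' => coface (g^~ t') s) t.
Proof.
rewrite /coface; under eq_bigr do rewrite scaler_sumr.
rewrite exchange_big; apply: eq_bigr => i _; rewrite scaler_sumr.
by apply: eq_bigr => j _; rewrite !scalerA commr_sign.
Qed.

Lemma size_del T i (s : seq T) : (i < size s)%N -> (size (del i s)).+1 = size s.
Proof.
move=> lis; rewrite size_cat size_takel ?size_drop; last exact: ltnW.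
by rewrite -addnS -subSn // subSS subnKC // ltnW.
Qed.

Lemma del_map T U (f : T -> U) i s : del i (map f s) = map f (del i s).
Proof. by rewrite /del map_cat map_take map_drop. Qed.

Lemma all_del T (a : pred T) i s : all a s -> all a (del i s).
Proof.
move=> h; rewrite all_cat; apply/andP; split.
  by move: h; rewrite -{1}(cat_take_drop i s) all_cat => /andP[].
by move: h; rewrite -{1}(cat_take_drop i.+1 s) all_cat => /andP[].
Qed.

Lemma coface_map T U (f : T -> U) (g : seq U -> M) s :
  coface g (map f s) = coface (fun r => g (map f r)) s.
Proof. by rewrite /coface size_map; apply: eq_bigr => i _; rewrite del_map. Qed.
End Coface.

Section LHS.
Variables (R : pzRingType) (gT : finGroupType) (H N : {group gT}) (M : lmodType R).

(* The Lyndon-Hochschild-Serre spectral sequence of N -> H -> H / N, with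
   coefficients in M with trivial action, is that of the double complex
     C^{n,m} = Hom_{H/N}(B_n(H/N), Hom_N(B_m(H), M)) = Hom_H(B_n(H/N) (x) B_m(H), M)
   where B denotes the homogeneous bar resolution, filtered by n. Thus an element
   of C^{n,m} is a function of an (n+1)-tuple in H / N and an (m+1)-tuple in H
   which is invariant under the diagonal left action of H. It is represented as
   a function on all pairs of sequences, extended by 0. *)
Definition tuples_in (s : seq (coset_of N) * seq gT) : bool :=
  all [in (H / N)%g] s.1 && all [in H] s.2.

Definition is_cell (s : seq (coset_of N) * seq gT) : bool :=
  [&& s.1 != [::], s.2 != [::] & tuples_in s].

Local Notation cochain := (seq (coset_of N) * seq gT -> M).

(* The total differential d' + (-1)^n d'', where n + 1 = size s.1. *)
Definition lhs_form (f : cochain) (s : seq (coset_of N) * seq gT) : M :=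
  coface (fun a => f (a, s.2)) s.1 +
  (-1 : R) ^+ (size s.1).+1 *: coface (fun b => f (s.1, b)) s.2.

Definition lhs_d_fun (f : cochain) : cochain :=
  fun s => if is_cell s then lhs_form f s else 0.

Lemma lhs_d_linear : linear lhs_d_fun.
Proof.
move=> c f g; apply/funext => s; rewrite /lhs_d_fun !fctE.
case: ifP => _; last by rewrite scaler0 addr0.
rewrite /lhs_form !cofaceD !cofaceZ !scalerDr addrACA !scalerA.
by rewrite commr_sign.
Qed.
HB.instance Definition _ := GRing.isLinear.Build R cochain cochain _ lhs_d_fun
  lhs_d_linear.
Definition lhs_d : {linear cochain -> cochain} := lhs_d_fun.

(* s has bidegree (n', m') with n <= n' and n' + m' = t. *)
Definition in_bidegree (n t : int) (s : seq (coset_of N) * seq gT) : bool :=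
  is_cell s && ((n + 1 <= (size s.1)%:Z) &&
                ((size s.1)%:Z + (size s.2)%:Z == t + 2)).

(* F^n of the degree t part of the total complex *)
Definition lhs_fil_pred (n t : int) : {pred cochain} := fun f =>
  `[< (forall s, f s != 0 -> in_bidegree n t s) /\
      (forall h a b, h \in H ->
         f (map (mulg (coset N h)) a, map (mulg h) b) = f (a, b)) >].

Lemma lhs_filP n t f : reflect
  ((forall s, f s != 0 -> in_bidegree n t s) /\
   (forall h a b, h \in H ->
         f (map (mulg (coset N h)) a, map (mulg h) b) = f (a, b)))
  (f \in lhs_fil_pred n t).
Proof. exact: asboolP. Qed.

Lemma lhs_fil_closed n t : submod_closed (lhs_fil_pred n t).
Proof.
split=> [|c f g /lhs_filP[f0 fi] /lhs_filP[g0 gi]]; apply/lhs_filP.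
  by split=> // s; rewrite eqxx.
split=> [s|h a b hH]; last by rewrite !fctE fi ?gi.
rewrite !fctE; apply: contraR => nd.
have /eqP -> : f s == 0 by apply: contraR nd; apply: f0.
have /eqP -> : g s == 0 by apply: contraR nd; apply: g0.
by rewrite scaler0 addr0.
Qed.
HB.instance Definition _ n t :=
  GRing.isSubmodClosed.Build R cochain (lhs_fil_pred n t) (lhs_fil_closed n t).
Definition lhs_fil n t : submodClosed cochain := lhs_fil_pred n t.

Lemma lhs_fil_decr n t f : f \in lhs_fil (n + 1) t -> f \in lhs_fil n t.
Proof.
move=> /lhs_filP[f0 fi]; apply/lhs_filP; split=> // s /f0 /and3P[c le e].
by apply/and3P; split=> //; apply: le_trans le; rewrite lerDl.
Qed.

Lemma tuples_in_act h a b : h \in H ->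
  tuples_in (map (mulg (coset N h)) a, map (mulg h) b) = tuples_in (a, b).
Proof.
move=> hH; rewrite /tuples_in /= !all_map; congr (_ && _); apply: eq_all => x /=.
  by rewrite groupMl ?mem_quotient.
by rewrite groupMl.
Qed.

Lemma is_cell_act h a b : h \in H ->
  is_cell (map (mulg (coset N h)) a, map (mulg h) b) = is_cell (a, b).
Proof.
by move=> hH; rewrite /is_cell tuples_in_act //=; case: a => //; case: b.
Qed.

Lemma lhs_fil_d n t f : f \in lhs_fil n t -> lhs_d f \in lhs_fil n (t + 1).
Proof.
move=> /lhs_filP[f0 fi]; apply/lhs_filP; split=> [[a b]|h a b hH] /=.
  apply: contraR; rewrite /lhs_d_fun /in_bidegree /= negb_and.
  case: ifP => //= c nd; have z x : ~~ in_bidegree n t x -> f x = 0.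
    by move=> nx; apply/eqP; apply: contraR nx; apply: f0.
  rewrite /lhs_form /= !coface0 ?scaler0 ?addr0 // => i /size_del e.
    apply: z; rewrite /in_bidegree; apply/and3P => -[_ /= le s2].
    by case/andP: nd; split; lia.
  apply: z; rewrite /in_bidegree; apply/and3P => -[_ /= le s2].
  by case/andP: nd; split; lia.
rewrite /lhs_d_fun is_cell_act //; case: ifP => // _.
rewrite /lhs_form /= !coface_map size_map; congr (_ + _ *: _).
  by apply: eq_coface => i _; rewrite fi.
by apply: eq_coface => i _; rewrite fi.
Qed.

Lemma lhs_dE n t f s : f \in lhs_fil n t -> tuples_in s -> lhs_d f s = lhs_form f s.
Proof.
move=> /lhs_filP[f0 _] ts; rewrite /= /lhs_d_fun; case: ifP => // nc.
have z x : ~~ is_cell x -> f x = 0.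
  by move=> nx; apply/eqP; apply: contraR nx => /f0 /andP[].
case: s ts nc => [[|x a] [|y b]] ts; rewrite /is_cell ?ts //= => _;
  rewrite /lhs_form /= !coface0 ?scaler0 ?addr0 //= => i _; apply: z;
  by rewrite /is_cell //= andbF.
Qed.

Lemma lhs_dd n t f : f \in lhs_fil n t -> lhs_d (lhs_d f) = 0.
Proof.
move=> fF; have /lhs_filP[f0 _] := fF; apply/funext => -[a b].
rewrite -[LHS]/(lhs_d_fun (lhs_d f) (a, b)) {1}/lhs_d_fun.
case: ifP => // /and3P[/= a0 b0 /andP[/= aH bH]].
rewrite /lhs_form /=.
rewrite (eq_coface (g' := fun a' => coface (fun a'' => f (a'', b)) a' +
   (-1 : R) ^+ (size a) *: coface (fun b' => f (a', b')) b)); last first.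
  move=> i lia; rewrite (lhs_dE fF) /lhs_form /= ?size_del //.
  by rewrite /tuples_in /= all_del.
rewrite (eq_coface (s := b) (g' := fun b' => coface (fun a' => f (a', b')) a +
   (-1 : R) ^+ (size a).+1 *: coface (fun b'' => f (a, b'')) b')); last first.
  move=> i lib; rewrite (lhs_dE fF) /lhs_form //=.
  by rewrite /tuples_in /= all_del ?andbT.
rewrite !cofaceD !cofaceZ !coface_coface scaler0 addr0 add0r.
by rewrite coface_comm exprS mulN1r scaleNr subrr.
Qed.

Definition lhs_complex : filtered_complex R :=
  FilteredComplex lhs_fil_decr lhs_fil_d lhs_dd.

Definition lhs_ss : ss_data R := fc_ss lhs_complex.
End LHS.

Section Pullback.
Local Open Scope group_scope.
Variables (R : pzRingType) (gT : finGroupType) (M : lmodType R).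
Variables (P N Q L : {group gT}) (phi : {morphism P >-> gT}).

(* The map P / N -> Q / L induced by phi: under the hypotheses below, it does not
   depend on the representative (coset_map_coset). *)
Definition coset_map (c : coset_of N) : coset_of L := coset L (phi (repr c)).

Local Notation cochain N := (seq (coset_of N) * seq gT -> M).

Definition pullback_fun (f : cochain L) : cochain N := fun s =>
  if is_cell P s then f (map coset_map s.1, map phi s.2) else 0.

Lemma pullback_linear : linear pullback_fun.
Proof.
move=> c f g; apply/funext => s; rewrite /pullback_fun !fctE.
by case: ifP => // _; rewrite scaler0 addr0.
Qed.
HB.instance Definition _ := GRing.isLinear.Build R (cochain L) (cochain N) _
  pullback_fun pullback_linear.

Hypotheses (nNP : N <| P) (nLQ : L <| Q).
Hypotheses (phiP : phi @* P \subset Q) (phiN : phi @* N \subset L).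

Lemma repr_coset_in c : c \in (P / N)%g -> repr c \in P.
Proof.
case/morphimP=> x nNx xP ->; have: repr (coset N x) \in coset N x by apply: mem_repr_coset.
rewrite val_coset // => /rcosetP[n nN ->]; rewrite groupM //.
exact: (subsetP (normal_sub nNP)).
Qed.

Lemma phi_in x : x \in P -> phi x \in Q.
Proof. by move=> xP; apply: (subsetP phiP); apply: mem_morphim. Qed.

Lemma coset_map_in c : c \in (P / N)%g -> coset_map c \in (Q / L)%g.
Proof. by move=> cP; apply/mem_quotient/phi_in/repr_coset_in. Qed.

Lemma coset_map_coset x : x \in P -> coset_map (coset N x) = coset L (phi x).
Proof.
move=> xP; have nNx := subsetP (normal_norm nNP) x xP.
have: repr (coset N x) \in coset N x by apply: mem_repr_coset.
rewrite /coset_map val_coset // => /rcosetP[n nN ->].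
have nP := subsetP (normal_sub nNP) n nN.
have fL : phi n \in L by apply: (subsetP phiN); apply: mem_morphim.
have nLx := subsetP (normal_norm nLQ) _ (phi_in xP).
rewrite (morphM phi) //.
rewrite (morphM (coset_morphism L)) ?(subsetP (normG L) _ fL) //.
by rewrite /= (coset_id fL) mul1g.
Qed.

Lemma coset_mapM h c : h \in P -> c \in (P / N)%g ->
  coset_map (coset N h * c)%g = (coset L (phi h) * coset_map c)%g.
Proof.
move=> hP /morphimP[x nNx xP ->].
have nNh := subsetP (normal_norm nNP) h hP.
have nL y (yP : y \in P) := subsetP (normal_norm nLQ) _ (phi_in yP).
rewrite -morphM // !coset_map_coset ?groupM // (morphM phi) //.
by rewrite (morphM (coset_morphism L)) ?nL.
Qed.

Lemma pullback_act h a b : h \in P -> tuples_in P (a, b) ->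
  (map coset_map (map (mulg (coset N h)) a), map phi (map (mulg h) b)) =
  (map (mulg (coset L (phi h))) (map coset_map a), map (mulg (phi h)) (map phi b)).
Proof.
move=> hP /andP[/allP /= aP /allP /= bP].
apply: congr2; rewrite -!map_comp; apply/eq_in_map => x xs /=.
  by rewrite coset_mapM ?aP.
by rewrite (morphM phi) // bP.
Qed.

Lemma pullback_tuples a b : tuples_in P (a, b) ->
  tuples_in Q (map coset_map a, map phi b).
Proof.
move=> /andP[/allP /= aP /allP /= bP]; rewrite /tuples_in /= !all_map.
by apply/andP; split; apply/allP => x xs /=; rewrite ?coset_map_in ?phi_in ?aP ?bP.
Qed.

Lemma pullback_fil n t f :
  f \in fc_fil (lhs_complex Q L M) n t ->
  pullback_fun f \in fc_fil (lhs_complex P N M) n t.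
Proof.
move=> /lhs_filP[f0 fi]; apply/lhs_filP; split=> [[a b]|h a b hP].
  rewrite /pullback_fun; case: ifP => [c /f0 /andP[_]|]; last by rewrite eqxx.
  by rewrite /in_bidegree c /= !size_map.
rewrite /pullback_fun is_cell_act //; case: ifP => // /and3P[_ _ ab] /=.
by rewrite pullback_act // fi ?phi_in.
Qed.

Lemma pullback_d n t f : f \in fc_fil (lhs_complex Q L M) n t ->
  pullback_fun (fc_d (lhs_complex Q L M) f) =
  fc_d (lhs_complex P N M) (pullback_fun f).
Proof.
move=> fF; have /lhs_filP[f0 _] := fF; apply/funext => -[a b].
rewrite /= /pullback_fun /lhs_d_fun /=; case: ifP => // /and3P[/= a0 b0 ab].
have pE a' b' : tuples_in P (a', b') ->
    f (map coset_map a', map phi b') =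
    if is_cell P (a', b') then f (map coset_map a', map phi b') else 0.
  move=> ab'; case: ifP => //; rewrite /is_cell ab' andbT /= => nc.
  apply/eqP; apply: contraFT nc => /f0 /andP[/and3P[]] /=.
  by case: a' {ab'} => //; case: b'.
rewrite [is_cell _ _]/is_cell pullback_tuples // andbT /=.
have -> : (map coset_map a != [::]) && (map phi b != [::]).
  by case: a a0 {ab} => //; case: b b0.
rewrite /lhs_form /= !coface_map size_map; have /andP[/= aP bP] := ab.
by congr (_ + _ *: _); apply: eq_coface => i _ /=; apply: pE;
  rewrite /tuples_in /= all_del ?aP.
Qed.

Definition pullback : fc_morphism (lhs_complex Q L M) (lhs_complex P N M) :=
  FcMorphism pullback_fil pullback_d.
End Pullback.

Section Fusion.
Local Open Scope group_scope.
Variables (gT : finGroupType).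
Implicit Types G K S T P Q : {group gT}.

(* phi is a morphism from P to Q of the fusion system F_S(G), for P, Q <= S:
   phi = c_g on P for some g in G with g P g^-1 <= Q. *)
Definition fusion_hom G P Q (phi : {morphism P >-> gT}) : Prop :=
  phi @* P \subset Q /\
  exists2 g, g \in G & {in P, forall x, phi x = (g * x * g^-1)%g}.

Definition strongly_closed G S T : Prop :=
  T \subset S /\
  forall P Q, P \subset S -> Q \subset S ->
  forall phi : {morphism P >-> gT}, fusion_hom G Q phi ->
    phi @* (P :&: T) \subset Q :&: T.

Lemma normal_strongly_closed G K S :
  K <| G -> strongly_closed G S (K :&: S)%G.
Proof.
move=> /andP[_ nKG]; split=> [|P Q sPS sQS phi [sphi [g gG phiE]]]; first exact: subsetIr.
apply/subsetP=> y /morphimP[x xP /setIP[_ /setIP[xK xS]] ->].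
have yQ : phi x \in Q by apply: (subsetP sphi); apply: mem_morphim.
rewrite !inE yQ (subsetP sQS) //= andbT phiE //.
have := memJ_norm x (subsetP nKG _ (groupVr gG)).
by rewrite conjgE invgK mulgA => ->.
Qed.

(* The pairs (P, phi) with P <= S and phi in Hom_F(P, S), where F = F_S(G). *)
Record fusion_arrow G S := FusionArrow {
  fa_dom : {group gT};
  fa_dom_sub : fa_dom \subset S;
  fa_mor : {morphism fa_dom >-> gT};
  fa_fusion : fusion_hom G S fa_mor
}.

Section Stable.
Variables (R : pzRingType) (M : lmodType R) (G S T : {group gT}).
Hypotheses (sSG : S \subset G) (scT : strongly_closed G S T).

Lemma strongly_closed_norm P : P \subset S -> P :&: T <| P.
Proof.
have [sTS cT] := scT; move=> sPS; rewrite /normal subsetIl normsI ?normG //.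
apply/subsetP=> g gP; rewrite inE; apply/subsetP=> _ /imsetP[x xT ->].
have gS := subsetP sPS g gP.
have f : fusion_hom G S (conjgm_morphism S g).
  split; first by rewrite morphim_conj setIid conjGid.
  by exists (g^-1)%g; rewrite ?groupV ?(subsetP sSG) // => y _; rewrite /= invgK -mulgA.
have /subsetP/(_ (x ^ g)%g) := cT S S (subxx _) (subxx _) _ f.
rewrite inE => /(_ _)/andP[] //.
apply/morphimP; exists x; rewrite ?inE ?(subsetP sTS) ?xT //.
Qed.

Lemma fusion_arrow_T (phi : fusion_arrow G S) :
  fa_mor phi @* (fa_dom phi :&: T) \subset S :&: T.
Proof. exact: scT.2 (fa_dom_sub phi) (subxx S) _ (fa_fusion phi). Qed.

Lemma idm_T P : P \subset S -> idm P @* (P :&: T) \subset S :&: T.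
Proof. by move=> sPS; rewrite morphim_idm ?subsetIl // setSI. Qed.

Lemma idm_S P : P \subset S -> idm P @* P \subset S.
Proof. by rewrite morphim_idm. Qed.

Definition extension_complex P : filtered_complex R :=
  lhs_complex P (P :&: T)%G M.

Definition fusion_pullback (phi : fusion_arrow G S) :
    fc_morphism (extension_complex S) (extension_complex (fa_dom phi)) :=
  pullback M (strongly_closed_norm (fa_dom_sub phi))
    (strongly_closed_norm (subxx S)) (fa_fusion phi).1 (fusion_arrow_T phi).

Definition inclusion_pullback (phi : fusion_arrow G S) :
    fc_morphism (extension_complex S) (extension_complex (fa_dom phi)) :=
  pullback M (strongly_closed_norm (fa_dom_sub phi))
    (strongly_closed_norm (subxx S))
    (idm_S (fa_dom_sub phi)) (idm_T (fa_dom_sub phi)).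

(* The F_S(G)-stable elements of the pages of the spectral sequence of
   S :&: T -> S -> S / (S :&: T). *)
Definition stable_ss : ss_data R := eq_ss fusion_pullback inclusion_pullback.
End Stable.
End Fusion.

(* Main.v *)
Require Import Defs.
From HB Require Import structures.
From mathcomp Require Import ssrAC.
From mathcomp Require Import all_boot all_order all_algebra all_fingroup all_solvable.
From mathcomp Require Import boolp functions.
From mathcomp Require Import zify.
Set Implicit Arguments.
Unset Strict Implicit.
Unset Printing Implicit Defensive.
Import Order.TTheory GRing.Theory Num.Theory.
Local Open Scope ring_scope.

(* Restriction and transfer between G and S are realized by maps of filtered
   complexes. A cochain of S is pulled back to an S-invariant cochain on the cells
   of G along S-equivariant retractions G / K -> S / T and G -> S, and then summed
   over the translates by S \ G; this is the transfer. On bar resolutions any two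
   equivariant maps of cells are homotopic, by a prism operator which lowers the
   filtration by at most one, so they agree on all pages from the second one on.
   Hence transfer o restriction is multiplication by the index [G : S]. In
   restriction o transfer, the term of the coset S g is the pullback along an
   equivariant map for h |-> g h g^-1 on P = S :&: S^g; it is homotopic to a map
   that factors through the cells of P, so on a stable element it acts as the
   identity modulo P-invariant boundaries. Summing over an S-orbit of cosets turns
   these into S-invariant boundaries, and the sum is again multiplication by
   [G : S], which is invertible in Z_(p). *)

(** * Prism operators and their boundary formula *)

Section Prism.
Variables (R : pzRingType) (M : lmodType R) (T U : Type) (al be : T -> U).
Implicit Types (f g : seq U -> M) (s : seq T).

(* \sum_i (-1)^i f(al x_0, ..., al x_i, be x_i, ..., be x_n) *)
Fixpoint prism f s : M :=
  if s is x :: s' then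
    f [:: al x, be x & map be s'] - prism (fun r => f (al x :: r)) s'
  else 0.

Lemma prism_lin c f g s :
  prism (fun r => c *: f r + g r) s = c *: prism f s + prism g s.
Proof.
elim: s f g => [|x s IH] f g /=; first by rewrite scaler0 addr0.
by rewrite IH scalerBr opprD addrACA.
Qed.

(** Every term of a prism evaluates the cochain on a list with one more entry than [s], all of whose
    entries are values of [al] or [be]; off such lists the cochain may be changed freely. *)
Lemma eq_prism (D : pred T) (D' : pred U) f g s :
  (forall x, D x -> D' (al x) && D' (be x)) -> all D s ->
  (forall r, size r = (size s).+1 -> all D' r -> f r = g r) ->
  prism f s = prism g s.
Proof.
move=> DD'; elim: s f g => //= x s IH f g /andP[Dx Ds] fg.
have /andP[ax bx] := DD' x Dx.
congr (_ - _).
  apply: fg; first by rewrite /= size_map.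
  rewrite /= ax bx all_map; apply: sub_all Ds => y /DD'.
  by case/andP.
by apply: IH => // r sr rD; apply: fg; rewrite /= ?sr ?ax.
Qed.

Lemma prism0 s : prism (fun=> 0) s = 0.
Proof. by elim: s => //= x s ->; rewrite subrr. Qed.

Lemma prism_coface V (f : seq U -> seq V -> M) s b :
  prism (fun a => coface (f a) b) s = coface (fun b' => prism (f^~ b') s) b.
Proof.
elim: s f => [|x s IH] f /=; first by rewrite coface0.
rewrite IH -scaleN1r -cofaceZ -cofaceD; apply: eq_coface => i _.
by rewrite scaleN1r.
Qed.

(** The inner faces of the prism cancel and its two ends remain. The induction splits off the first
    vertex and uses the hypothesis for [f] with [al x] prepended. *)
Lemma coface_prism f s :
  coface (prism f) s + prism (coface f) s = f (map be s) - f (map al s).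
Proof.
elim: s f => [|x s IH] f /=; first by rewrite /coface big_ord0 subrr addr0.
rewrite coface_cons !coface_cons coface_map.
rewrite (eq_coface (g := fun r => prism f (x :: r)) (g' := fun r =>
  f [:: al x, be x & map be r] + -1 *: prism (fun q => f (al x :: q)) r)); last first.
  by move=> i _; rewrite scaleN1r.
rewrite cofaceD cofaceZ scaleN1r.
have -> : prism (fun r => coface f (al x :: r)) s =
    - prism (coface (fun q => f (al x :: q))) s + prism f s.
  rewrite -scaleN1r -prism_lin; elim: (s) (f) => // y s' IH' f'.
  congr (prism _ _); apply/funext => r; by rewrite coface_cons scaleN1r addrC.
have := IH (fun q => f (al x :: q)).
move: (coface (prism _) s) (prism (coface _) s) => A B.
move: (coface _ s) (prism f s) => C D /(canRL (addrK _)) ->.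
rewrite !(opprD, opprB, opprK, addrA).
(* Of the ten terms, the first pair of the pattern is the right-hand side and the other four pairs
   cancel. *)
by rewrite [LHS](ACl ((6*4)*(1*10)*(8*2)*(3*7)*(9*5))) /= !subrr !addr0.
Qed.

End Prism.

(** Naturality of the prism; with translations for [ga] and [de] it yields the invariance of the
    homotopies below. *)
Lemma prism_map (R : pzRingType) (M : lmodType R) (T U V W : Type)
    (al be : T -> U) (al' be' : V -> W) (ga : V -> T) (de : W -> U)
    (D : pred V) (f : seq U -> M) (s : seq V) :
  (forall x, D x -> al (ga x) = de (al' x) /\ be (ga x) = de (be' x)) ->
  all D s ->
  prism al be f (map ga s) = prism al' be' (fun r => f (map de r)) s.
Proof.
move=> e; elim: s f => //= x s IH f /andP[/e[-> ->] Ds].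
congr (_ - _); last by rewrite IH.
congr f; congr [:: _, _ & _]; rewrite -!map_comp.
by elim: s Ds {IH} => //= y s IH /andP[/e[_ ->] /IH ->].
Qed.

(** * Partially invariant cochains and pullbacks along maps of vertices *)

Section Pull.
Variables (R : pzRingType) (gT : finGroupType) (M : lmodType R).
Implicit Types (H N L : {group gT}) (A : {set gT}).

Local Notation cochain N := (seq (coset_of N) * seq gT -> M).

(** [lhs_fil] with the set [A] of invariance separated from the group [H] that carries the cells:
    the transfer passes through cochains on the cells of [G] that are invariant only under [S], and
    [A := set0] keeps the support condition alone. *)
Definition inv_fil A H N n t (f : cochain N) : Prop :=
  (forall s, f s != 0 -> in_bidegree H n t s) /\
  (forall h a b, h \in A ->
     f (map (mulg (coset N h)) a, map (mulg h) b) = f (a, b)).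

Definition inv_Z A H N (k : nat) (n t : int) (f : cochain N) : Prop :=
  inv_fil A H n t f /\ inv_fil A H (n + k%:Z) (t + 1) (lhs_d H N M f).

Definition inv_B A H N (k : nat) (n t : int) (f : cochain N) : Prop :=
  exists y w, [/\ inv_Z A H k.-1 (n + 1) t y,
    inv_Z A H k.-1 (n - k%:Z + 1) (t - 1) w & f = y + lhs_d H N M w].

Lemma lhs_fc_Z H N k n t (f : cochain N) :
  f \in fc_Z (lhs_complex H N M) k n t <-> inv_Z H H k n t f.
Proof.
split=> [/fc_ZP[/lhs_filP ? /lhs_filP ?]|[? ?]] //.
by apply/fc_ZP; split; apply/lhs_filP.
Qed.

Lemma lhs_fc_B H N k n t (f : cochain N) :
  f \in fc_B (lhs_complex H N M) k n t <-> inv_B H H k n t f.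
Proof.
split=> [/fc_BP|] [y [w [yZ wZ ->]]]; last apply/fc_BP;
  by exists y, w; split=> //; apply/lhs_fc_Z.
Qed.

Section Closure.
Variables (A : {set gT}) (H N : {group gT}).
Implicit Types f g : cochain N.

Lemma inv_fil_lin c n t f g : inv_fil A H n t f -> inv_fil A H n t g ->
  inv_fil A H n t (c *: f + g).
Proof.
move=> [f0 fi] [g0 gi]; split=> [s|h a b hA]; last by rewrite !fctE fi ?gi.
rewrite !fctE; apply: contraR => nd.
have /eqP -> : f s == 0 by apply: contraR nd; apply: f0.
have /eqP -> : g s == 0 by apply: contraR nd; apply: g0.
by rewrite scaler0 addr0.
Qed.

Lemma inv_fil0 n t : inv_fil A H n t (0 : cochain N).
Proof. by split=> // s; rewrite eqxx. Qed.

Lemma inv_fil_le n n' t f : n' <= n -> inv_fil A H n t f -> inv_fil A H n' t f.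
Proof.
move=> le [f0 fi]; split=> // s /f0 /and3P[c le' e].
by apply/and3P; split=> //; apply: le_trans le'; rewrite lerD2r.
Qed.

Lemma inv_Z_lin c k n t f g : inv_Z A H k n t f -> inv_Z A H k n t g ->
  inv_Z A H k n t (c *: f + g).
Proof. by move=> [? ?] [? ?]; split; rewrite ?linearP; apply: inv_fil_lin. Qed.

Lemma inv_B_lin c k n t f g : inv_B A H k n t f -> inv_B A H k n t g ->
  inv_B A H k n t (c *: f + g).
Proof.
move=> [y [w [yZ wZ ->]]] [y' [w' [y'Z w'Z ->]]].
exists (c *: y + y'), (c *: w + w'); split; try exact: inv_Z_lin.
by rewrite linearP scalerDr addrACA.
Qed.

Lemma inv_BD k n t f g : inv_B A H k n t f -> inv_B A H k n t g ->
  inv_B A H k n t (f + g).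
Proof. by rewrite -[f]scale1r => ? ?; apply: inv_B_lin => //; rewrite -[f]scale1r. Qed.
End Closure.

Definition pull_fun H N L (al : coset_of N -> coset_of L) (be : gT -> gT)
    (f : cochain L) : cochain N :=
  fun s => if is_cell H s then f (map al s.1, map be s.2) else 0.

Lemma pull_linear H N L al be : linear (@pull_fun H N L al be).
Proof.
move=> c f g; apply/funext => s; rewrite /pull_fun !fctE.
by case: ifP => // _; rewrite scaler0 addr0.
Qed.
HB.instance Definition _ H N L al be :=
  GRing.isLinear.Build R (cochain L) (cochain N) _ (@pull_fun H N L al be)
    (pull_linear H al be).
Definition pull H N L al be : {linear cochain L -> cochain N} :=
  @pull_fun H N L al be.

Definition maps_cells H N H' L (al : coset_of N -> coset_of L) (be : gT -> gT) :=
  {in (H / N)%g, forall c, al c \in (H' / L)%g} /\ {in H, forall y, be y \in H'}.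

Definition equivariant A H N L (phi : gT -> gT)
    (al : coset_of N -> coset_of L) (be : gT -> gT) :=
  forall h, h \in A ->
    {in (H / N)%g, forall c, al (coset N h * c)%g = (coset L (phi h) * al c)%g} /\
    {in H, forall y, be (h * y)%g = (phi h * be y)%g}.

Section Maps.
Variables (H N H' L : {group gT}).
Variables (al : coset_of N -> coset_of L) (be : gT -> gT).
Hypothesis dom : maps_cells H H' al be.

Lemma tuples_in_map s : tuples_in H s -> tuples_in H' (map al s.1, map be s.2).
Proof.
case: dom => dal dbe /andP[/allP /= aH /allP /= bH]; rewrite /tuples_in /= !all_map.
by apply/andP; split; apply/allP => x xs /=; rewrite ?dal ?dbe ?aH ?bH.
Qed.

Lemma is_cell_map s : is_cell H s -> is_cell H' (map al s.1, map be s.2).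
Proof.
case/and3P=> s1 s2 ts; rewrite /is_cell tuples_in_map // andbT /=.
by case: s s1 s2 {ts} => [[|? ?] [|? ?]].
Qed.

(** Faces are formed by deleting vertices, which commutes with any map applied vertex by vertex. *)
Lemma pull_d f : (forall s, f s != 0 -> is_cell H' s) ->
  pull H al be (lhs_d H' L M f) = lhs_d H N M (pull H al be f).
Proof.
move=> f0; apply/funext => -[a b].
rewrite /= /pull_fun /lhs_d_fun /=; case: ifP => // cab.
rewrite (is_cell_map cab); have /and3P[/= _ _ ab] := cab.
(* A face may have an empty component; it is then no cell, and [f] vanishes on its image as well. *)
have pE a' b' : tuples_in H (a', b') ->
    f (map al a', map be b') =
    if is_cell H (a', b') then f (map al a', map be b') else 0.
  move=> ab'; case: ifP => //; rewrite /is_cell ab' andbT /= => nc.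
  apply/eqP; apply: contraFT nc => /f0 /and3P[] /=.
  by case: a' {ab'} => //; case: b'.
rewrite /lhs_form /= !coface_map size_map; have /andP[/= aP bP] := ab.
by congr (_ + _ *: _); apply: eq_coface => i _ /=; apply: pE;
  rewrite /tuples_in /= all_del ?aP.
Qed.

Lemma pull_comp (J : {group gT}) (al' : coset_of L -> coset_of J) be' (f : cochain J) :
  pull H al be (pull H' al' be' f) = pull H (al' \o al) (be' \o be) f.
Proof.
apply/funext => s; rewrite /= /pull_fun; case: ifP => // /is_cell_map -> /=.
by rewrite -!map_comp.
Qed.

Variables (A A' : {set gT}) (phi : gT -> gT).
Hypotheses (sAH : A \subset H) (phiA : {in A, forall h, phi h \in A'}).
Hypothesis eqv : equivariant A H phi al be.

Lemma equivariant_map h s : h \in A -> tuples_in H s ->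
  (map al (map (mulg (coset N h)) s.1), map be (map (mulg h) s.2)) =
  (map (mulg (coset L (phi h))) (map al s.1), map (mulg (phi h)) (map be s.2)).
Proof.
move=> /eqv[ea eb] /andP[/allP /= aP /allP /= bP].
apply: congr2; rewrite -!map_comp; apply/eq_in_map => x xs /=.
  by rewrite ea ?aP.
by rewrite eb ?bP.
Qed.

Lemma pull_fil n t f : inv_fil A' H' n t f -> inv_fil A H n t (pull H al be f).
Proof.
move=> [f0 fi]; split=> [[a b]|h a b hA].
  rewrite /= /pull_fun; case: ifP => [c /f0 /andP[_]|]; last by rewrite eqxx.
  by rewrite /in_bidegree c /= !size_map.
have hH := subsetP sAH h hA.
rewrite /= /pull_fun is_cell_act //; case: ifP => // /and3P[_ _ ab] /=.
have [-> ->] := equivariant_map hA ab.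
by rewrite fi // phiA.
Qed.

Lemma pull_Z k n t f : inv_Z A' H' k n t f -> inv_Z A H k n t (pull H al be f).
Proof.
move=> [fF dfF]; split; first exact: pull_fil.
rewrite -pull_d; first exact: pull_fil.
by move=> s /fF.1 /andP[].
Qed.

Lemma pull_B k n t f : inv_B A' H' k n t f -> inv_B A H k n t (pull H al be f).
Proof.
move=> [y [w [yZ wZ ->]]]; exists (pull H al be y), (pull H al be w).
split; try exact: pull_Z.
by rewrite linearD pull_d // => s /wZ.1.1 /andP[].
Qed.
End Maps.

Lemma eq_pull (H N L : {group gT}) (al al' : coset_of N -> coset_of L) be be'
    (f : cochain L) :
  {in (H / N)%g, al =1 al'} -> {in H, be =1 be'} ->
  pull H al be f = pull H al' be' f.
Proof.
move=> ea eb; apply/funext => -[a b]; rewrite /= /pull_fun; case: ifP => //.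
case/and3P=> _ _ /andP[/allP /= aH /allP /= bH].
congr f; congr (_, _); apply/eq_in_map => x; first by move/aH/ea.
by move/bH/eb.
Qed.

Lemma pull_id (A : {set gT}) (H N : {group gT}) n t
    (f : cochain N) :
  inv_fil A H n t f -> pull H id id f = f.
Proof.
move=> [f0 _]; apply/funext => -[a b]; rewrite /= /pull_fun /= !map_id.
by case: ifP => // nc; apply/esym/eqP; apply: contraFT nc => /f0 /andP[].
Qed.

End Pull.

(** * Homotopies between equivariant maps of cells *)

Section Homotopy.
Variables (R : pzRingType) (gT : finGroupType) (M : lmodType R).
Variables (H N H' L : {group gT}) (A : {set gT}) (phi : gT -> gT).
Hypotheses (sAH : A \subset H) (phiA : {in A, forall h, phi h \in H'}).

Local Notation cochain N := (seq (coset_of N) * seq gT -> M).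

(* A homotopy that lowers the filtration by at most 1 does not affect the pages
   from the second one on. *)
Lemma homotopy_B (h u : cochain L -> cochain N) k n t x :
  (1 < k)%N -> h 0 = 0 ->
  (forall n t f, inv_fil H' H' n t f -> inv_fil A H (n - 1) (t - 1) (h f)) ->
  (forall n t f, inv_fil H' H' n t f -> inv_fil A H n t (u f)) ->
  (forall n t f, inv_fil H' H' n t f ->
     u f = h (lhs_d H' L M f) + lhs_d H N M (h f)) ->
  inv_Z H' H' k n t x -> inv_B A H k n t (u x).
Proof.
move=> k1 h0 hF uF htp [xF dxF].
have uE := htp _ _ _ xF; have udE := htp _ _ _ dxF.
have ddx : lhs_d H' L M (lhs_d H' L M x) = 0.
  by apply: (@lhs_dd _ _ _ _ _ n t); apply/lhs_filP.
have hxF := hF _ _ _ xF; have hdxF := hF _ _ _ dxF; rewrite addrK in hdxF.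
have dh : lhs_d H N M (h x) = u x - h (lhs_d H' L M x) by rewrite uE addrAC subrr add0r.
(* Since dx has filtration n + k, h(dx) has filtration n + k - 1 >= n + 1, and h(x) has n - 1 >= n -
   k + 1; both inequalities amount to 2 <= k. *)
exists (h (lhs_d H' L M x)), (h x); split=> //; split.
- by apply: inv_fil_le hdxF; lia.
(* As ddx = 0, the homotopy formula at dx reads u(dx) = d(h(dx)), so this boundary has filtration n
   + k. *)
- rewrite ddx h0 add0r in udE; rewrite -udE.
  by apply: inv_fil_le (uF _ _ _ dxF); lia.
- by apply: inv_fil_le hxF; lia.
rewrite dh subrK [u x - _]addrC -scaleN1r; apply: inv_fil_lin.
  by apply: inv_fil_le hdxF; lia.
by apply: inv_fil_le (uF _ _ _ xF); lia.
Qed.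

Section Prism.
Variables (al al' : coset_of N -> coset_of L) (be be' : gT -> gT).
Hypotheses (dom : maps_cells H H' al be) (dom' : maps_cells H H' al' be').
Hypotheses (eqv : equivariant A H phi al be) (eqv' : equivariant A H phi al' be').

(** The passage from [(al, be)] to [(al', be')] changes one factor of a cell at a time: [prism_left]
    changes the coset factor while [be] is kept, and [prism_right] the group factor once [al'] is in
    place, with the sign of d'' built in. *)
Definition prism_left (f : cochain L) : cochain N := fun s =>
  if is_cell H s then prism al al' (fun a => f (a, map be s.2)) s.1 else 0.

Definition prism_right (f : cochain L) : cochain N := fun s =>
  if is_cell H s then
    (-1 : R) ^+ (size s.1).+1 *: prism be be' (fun b => f (map al' s.1, b)) s.2
  else 0.

Lemma prism_domL x : x \in (H / N)%g ->
  (al x \in (H' / L)%g) && (al' x \in (H' / L)%g).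
Proof. by move=> xH; rewrite dom.1 ?dom'.1. Qed.

Lemma prism_domR x : x \in H -> (be x \in H') && (be' x \in H').
Proof. by move=> xH; rewrite dom.2 ?dom'.2. Qed.

Lemma prism_left_fil n t f : inv_fil H' H' n t f ->
  inv_fil A H (n - 1) (t - 1) (prism_left f).
Proof.
move=> [f0 fi]; split=> [[a b]|h a b hA].
  apply: contraR; rewrite /prism_left /in_bidegree /= negb_and.
  case: ifP => //= /and3P[_ _ /andP[aH bH]] nd.
  rewrite (eq_prism (g := fun=> 0) prism_domL aH) ?prism0 // => r sr _.
  apply/eqP; apply: contraR nd => /f0 /and3P[_ /=]; rewrite sr !size_map /=.
  by move=> ? ?; apply/andP; split; lia.
have hH := subsetP sAH h hA.
rewrite /prism_left is_cell_act //; case: ifP => //= /and3P[_ _ /andP[/= aH bH]].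
rewrite (prism_map (al' := al) (be' := al') (de := mulg (coset L (phi h)))
  (D := [in (H / N)%g])) //; last first.
  by move=> x xH; rewrite (eqv hA).1 ?(eqv' hA).1.
congr prism; apply/funext => r /=; rewrite -(fi (phi h) r) ?phiA //.
congr f; congr (_, _); rewrite -!map_comp; apply/eq_in_map => y yb /=.
by rewrite (eqv hA).2 // (allP bH).
Qed.

(** The first factor keeps its size, so the filtration does not even drop; n - 1 is the form that
    [homotopy_B] takes for both prisms. *)
Lemma prism_right_fil n t f : inv_fil H' H' n t f ->
  inv_fil A H (n - 1) (t - 1) (prism_right f).
Proof.
move=> [f0 fi]; split=> [[a b]|h a b hA].
  apply: contraR; rewrite /prism_right /in_bidegree /= negb_and.
  case: ifP => //= /and3P[_ _ /andP[aH bH]] nd.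
  rewrite (eq_prism (g := fun=> 0) prism_domR bH) ?prism0 ?scaler0 // => r sr _.
  apply/eqP; apply: contraR nd => /f0 /and3P[_ /=]; rewrite sr !size_map /=.
  by move=> ? ?; apply/andP; split; lia.
have hH := subsetP sAH h hA.
rewrite /prism_right is_cell_act //; case: ifP => //= /and3P[_ _ /andP[/= aH bH]].
rewrite (prism_map (al' := be) (be' := be') (de := mulg (phi h))
  (D := [in H])) //; last first.
  by move=> x xH; rewrite (eqv hA).2 ?(eqv' hA).2.
rewrite size_map; congr (_ *: _).
congr prism; apply/funext => r /=; rewrite -(fi (phi h) _ r) ?phiA //.
congr f; congr (_, _); rewrite -!map_comp; apply/eq_in_map => y yb /=.
by rewrite (eqv' hA).1 // (allP aH).
Qed.

(** The d' parts form the prism identity in the first factor. The d'' parts commute with the prism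
    but carry opposite signs, since the prism adds a vertex to the first factor, and cancel. *)
Lemma prism_leftP n t f : inv_fil H' H' n t f ->
  pull M H al' be f - pull M H al be f =
    prism_left (lhs_d H' L M f) + lhs_d H N M (prism_left f).
Proof.
move=> fF; have [f0 _] := fF; have fF' : f \in lhs_fil H' L M n t by apply/lhs_filP.
have fz s : ~~ is_cell H' s -> f s = 0.
  by move=> ns; apply/eqP; apply: contraR ns => /f0 /andP[].
apply/funext => -[a b].
rewrite /= !fctE /= /pull_fun /prism_left /lhs_d_fun /=.
case: ifP => [|_]; last by rewrite subrr addr0.
case/and3P=> /= a0 b0 ab; have /andP[/= aH bH] := ab.
have bH' : all [in H'] (map be b).
  by rewrite all_map; apply: sub_all bH => y /prism_domR/andP[].
rewrite (eq_prism (D' := [in (H' / L)%g]) (g := fun a' =>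
  (-1 : R) ^+ (size a).+2 *: coface (fun b' => f (a', b')) (map be b) +
  coface (fun a'' => f (a'', map be b)) a') prism_domL aH); last first.
  move=> r sr rH; have := lhs_dE (s := (r, map be b)) fF'.
  rewrite /= /lhs_d_fun => ->; first by rewrite /lhs_form /= sr addrC.
  by rewrite /tuples_in /= rH.
rewrite prism_lin prism_coface coface_map /lhs_form /=.
(* Deleting the only vertex leaves no cell. The guarded value is then 0, and so is the prism: over
   an empty list here, and of a zero cochain in the next rewriting. *)
rewrite (eq_coface (s := a) (g' := prism al al' (fun a' => f (a', map be b)))); last first.
  move=> i lia; case: ifP => //; rewrite /is_cell /= b0 /tuples_in /= bH all_del //= !andbT.
  by case: (del i a).
rewrite (eq_coface (s := b)
    (g' := fun b' => prism al al' (fun a' => f (a', map be b')) a)); last first.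
  move=> i lib; case: ifP => //; rewrite /is_cell /= a0 /tuples_in /= aH all_del //= !andbT.
  case: (del i b) => // _; rewrite (_ : (fun a' => f (a', _)) = fun=> 0) ?prism0 //.
  by apply/funext => a'; rewrite fz // /is_cell /= andbF.
rewrite exprS mulN1r scaleNr.
have := coface_prism al al' (fun a' => f (a', map be b)) a.
set X := coface _ a; set Y := prism _ _ _ a; set Z := _ *: _.
by move=> <-; rewrite [RHS](AC (2*2) ((3*2)*(1*4))) /= addNr addr0.
Qed.

(** Here the d'' parts form the prism identity, with [sg] occurring twice; deleting a vertex of the
    first factor reverses [sg], so the d' parts cancel. *)
Lemma prism_rightP n t f : inv_fil H' H' n t f ->
  pull M H al' be' f - pull M H al' be f =
    prism_right (lhs_d H' L M f) + lhs_d H N M (prism_right f).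
Proof.
move=> fF; have [f0 _] := fF; have fF' : f \in lhs_fil H' L M n t by apply/lhs_filP.
have fz s : ~~ is_cell H' s -> f s = 0.
  by move=> ns; apply/eqP; apply: contraR ns => /f0 /andP[].
apply/funext => -[a b].
rewrite /= !fctE /= /pull_fun /prism_right /lhs_d_fun /=.
case: ifP => [|_]; last by rewrite subrr addr0.
case/and3P=> /= a0 b0 ab; have /andP[/= aH bH] := ab.
have aH' : all [in (H' / L)%g] (map al' a).
  by rewrite all_map; apply: sub_all aH => y /prism_domL/andP[].
pose sg : R := (-1) ^+ (size a).+1; rewrite -/sg.
have sgK x : sg *: (sg *: x) = x :> M.
  by rewrite scalerA -expr2 sqrr_sign scale1r.
rewrite (eq_prism (D' := [in H']) (g := fun b' =>
  sg *: coface (fun b'' => f (map al' a, b'')) b' +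
  coface (fun a'' => f (a'', b')) (map al' a)) prism_domR bH); last first.
  move=> r sr rH; have := lhs_dE (s := (map al' a, r)) fF'.
  rewrite /= /lhs_d_fun => ->; first by rewrite /lhs_form /= size_map addrC.
  by rewrite /tuples_in /= aH'.
rewrite prism_lin prism_coface coface_map /lhs_form /= scalerDr sgK -/sg.
rewrite (eq_coface (s := a) (g := fun a' => if is_cell H (a', b) then _ else 0)
  (g' := fun a' =>
    - sg *: prism be be' (fun b' => f (map al' a', b')) b)); last first.
  move=> i lia; rewrite size_del //.
  have -> : (-1) ^+ size a = - sg by rewrite /sg exprS mulN1r opprK.
  case: ifP => //; rewrite /is_cell /= b0 /tuples_in /= bH all_del //= !andbT.
  case: (del i a) => // _; rewrite (_ : (fun b' => f (_, b')) = fun=> 0).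
    by rewrite prism0 scaler0.
  by apply/funext => b'; rewrite fz // /is_cell.
rewrite (eq_coface (s := b) (g := fun b' => if is_cell H (a, b') then _ else 0)
  (g' := fun b' => sg *: prism be be' (fun b' => f (map al' a, b')) b')); last first.
  move=> i lib; case: ifP => //; rewrite /is_cell /= a0 /tuples_in /= aH all_del //= !andbT.
  by case: (del i b) => // _; rewrite scaler0.
rewrite !cofaceZ sgK scaleNr.
have := coface_prism be be' (fun b' => f (map al' a, b')) b.
set X := coface _ b; set Y := prism _ _ _ b; set Z := _ *: _.
by move=> <-; rewrite [RHS](AC (2*2) ((4*1)*(2*3))) /= subrr addr0.
Qed.

(** The two prisms are joined at the intermediate pair [(al', be)], whose pullback is [v].
    Equivariance for one common [phi] is what makes the resulting boundary [A]-invariant. *)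
Lemma pull_homotopic k n t x : (1 < k)%N -> inv_Z H' H' k n t x ->
  inv_B A H k n t (pull M H al' be' x - pull M H al be x).
Proof.
move=> k1 xZ; pose v := pull M H al' be x.
have dom1 : maps_cells H H' al' be by split; [exact: dom'.1 | exact: dom.2].
have eqv1 : equivariant A H phi al' be.
  by move=> h hA; split; [exact: (eqv' hA).1 | exact: (eqv hA).2].
have sub (f g : cochain N) n' t' : inv_fil A H n' t' f -> inv_fil A H n' t' g ->
    inv_fil A H n' t' (f - g).
  by move=> fF gF; rewrite addrC -scaleN1r; apply: inv_fil_lin.
rewrite -(subrKA v); apply: inv_BD.
  apply: (@homotopy_B prism_right (fun f => pull M H al' be' f - pull M H al' be f)) xZ => //.
  - by apply/funext=> s; rewrite /prism_right prism0 scaler0 if_same.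
  - exact: prism_right_fil.
  - move=> ? ? f fF; apply: sub; first exact (pull_fil sAH phiA eqv' fF).
    exact (pull_fil sAH phiA eqv1 fF).
  exact: prism_rightP.
apply: (@homotopy_B prism_left (fun f => pull M H al' be f - pull M H al be f)) xZ => //.
- by apply/funext=> s; rewrite /prism_left prism0 if_same.
- exact: prism_left_fil.
- move=> ? ? f fF; apply: sub; first exact (pull_fil sAH phiA eqv1 fF).
  exact (pull_fil sAH phiA eqv fF).
exact: prism_leftP.
Qed.
End Prism.
End Homotopy.

(** * Translations and equivariant retractions *)

Section EquivariantMaps.
Local Open Scope group_scope.
Variable gT : finGroupType.
Implicit Types (H N L J P Q S : {group gT}) (A B : {set gT}) (phi : gT -> gT).

Lemma maps_cells_comp H H' H'' N L J (al : coset_of N -> coset_of L) be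
    (al' : coset_of L -> coset_of J) be' :
  maps_cells H H' al be -> maps_cells H' H'' al' be' ->
  maps_cells H H'' (al' \o al) (be' \o be).
Proof. by move=> [a b] [a' b']; split=> x xH; [apply/a'/a | apply/b'/b]. Qed.

Lemma equivariant_comp A A' H H' N L J phi phi'
    (al : coset_of N -> coset_of L) be (al' : coset_of L -> coset_of J) be' :
  maps_cells H H' al be -> {in A, forall h, phi h \in A'} ->
  equivariant A H phi al be -> equivariant A' H' phi' al' be' ->
  equivariant A H (phi' \o phi) (al' \o al) (be' \o be).
Proof.
move=> [a b] phiA e e' h hA; have [ea eb] := e h hA.
by have [ea' eb'] := e' _ (phiA h hA); split=> x xH /=; rewrite ?ea ?ea' ?a ?eb ?eb' ?b.
Qed.

Lemma equivariant_sub A B H N L phi (al : coset_of N -> coset_of L) be :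
  A \subset B -> equivariant B H phi al be -> equivariant A H phi al be.
Proof. by move=> /subsetP sAB e h /sAB /e. Qed.

Lemma equivariant_eq A H N L phi phi'
    (al : coset_of N -> coset_of L) be :
  {in A, phi =1 phi'} -> equivariant A H phi al be -> equivariant A H phi' al be.
Proof. by move=> e eqv h hA; rewrite -e //; apply: eqv. Qed.

Lemma coset_mapP P N Q L (phi : {morphism P >-> gT}) :
  N <| P -> L <| Q -> phi @* P \subset Q -> phi @* N \subset L ->
  maps_cells P Q (coset_map (N := N) L phi) phi /\
  equivariant P P phi (coset_map (N := N) L phi) phi.
Proof.
move=> nNP nLQ phiP phiN; split=> [|h hP]; split=> x xP.
- exact: coset_map_in nNP phiP _ xP.
- exact: phi_in phiP _ xP.
- exact: coset_mapM nNP nLQ phiP phiN _ _ hP xP.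
- exact: morphM.
Qed.

Section Translations.
Variables (H N : {group gT}) (g : gT).
Hypotheses (nNH : N <| H) (gH : g \in H).

Lemma coset_mulH x y : x \in H -> y \in H ->
  coset N (x * y) = coset N x * coset N y.
Proof. by move=> xH yH; rewrite morphM // (subsetP (normal_norm nNH)). Qed.

Lemma maps_cells_ltrans : maps_cells H H (mulg (coset N g)) (mulg g).
Proof. by split=> x xH; rewrite groupM ?mem_quotient. Qed.

Lemma equivariant_ltrans :
  equivariant H H (fun h => g * h * g^-1) (mulg (coset N g)) (mulg g).
Proof.
move=> h hH; split=> x xH; last by rewrite !mulgA mulgKV.
by rewrite !mulgA -!coset_mulH ?groupM ?groupV // mulgKV.
Qed.

Lemma maps_cells_rtrans : maps_cells H H (mulg^~ (coset N g)) (mulg^~ g).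
Proof. by split=> x xH; rewrite groupM ?mem_quotient. Qed.

(** Right translation commutes with the left action, so it is homotopic to the identity; in
    [res_stable] this makes conjugation in [G] act trivially. *)
Lemma equivariant_rtrans : equivariant H H id (mulg^~ (coset N g)) (mulg^~ g).
Proof. by move=> h hH; split=> x xH; rewrite mulgA. Qed.
End Translations.

(** The factor b in x = b r, where r is the chosen representative of [B :* x]; it is [B]-equivariant
    because r depends on the coset only. *)
Definition retract (rT : finGroupType) (B : {set rT}) (x : rT) : rT :=
  x * (repr (B :* x))^-1.

Lemma retract_in (rT : finGroupType) (B : {group rT}) x : retract B x \in B.
Proof.
have /rcosetP[b bB e] := mem_repr_rcoset B x.
by rewrite /retract e invMg mulgA mulgV mul1g groupV.
Qed.

Lemma retractM (rT : finGroupType) (B : {group rT}) b x : b \in B ->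
  retract B (b * x) = b * retract B x.
Proof. by move=> bB; rewrite /retract rcosetM rcoset_id // mulgA. Qed.

Section Retract.
Variables (S G K T : {group gT}).
Hypotheses (sSG : S \subset G) (nKG : K <| G) (nTS : T <| S).
Hypothesis SK_sub_T : S :&: K \subset T.

(* G / K -> S / T: retract onto the image of S, then lift to S *)
Definition retract_coset (c : coset_of K) : coset_of T :=
  coset T (repr (retract (S / K) c :&: S)).

(** Two elements of [S] in one coset of [K] differ by an element of [S :&: K], which lies in [T]. *)
Lemma lift_coset s : s \in S -> coset T (repr (coset K s :&: S)) = coset T s.
Proof.
move=> sS; have nKs := subsetP (normal_norm nKG) s (subsetP sSG s sS).
have : s \in coset K s :&: S by rewrite inE sS val_coset // rcoset_refl.
move/mem_repr; rewrite inE val_coset // => /andP[/rcosetP[k kK ->]].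
rewrite (groupMr _ sS) => kS.
by rewrite coset_kerl // (subsetP SK_sub_T) // inE kS.
Qed.

Lemma maps_cells_retract : maps_cells G S retract_coset (retract S).
Proof.
split=> [c _|y _]; last exact: retract_in.
have /morphimP[s _ sS e] := retract_in (S / K)%G c.
by rewrite /retract_coset e /= lift_coset // mem_quotient.
Qed.

Lemma equivariant_retract : equivariant S G id retract_coset (retract S).
Proof.
move=> h hS; split=> c _; last exact: retractM.
rewrite /retract_coset retractM ?mem_quotient //.
have /morphimP[s _ sS e] := retract_in (S / K)%G c.
rewrite (e : retract (S / K) c = coset K s).
rewrite -(coset_mulH nKG) ?(subsetP sSG) // !lift_coset ?groupM //.
by rewrite (coset_mulH nTS).
Qed.
End Retract.
End EquivariantMaps.

(** * Sums of equivariant families over cosets *)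

Section Transfer.
Variables (R : pzRingType) (gT : finGroupType) (M : lmodType R).
Variables (H N : {group gT}).
Hypothesis nNH : (N <| H)%g.
Implicit Types (A B : {set gT}) (g h : gT).

Local Notation cochain := (seq (coset_of N) * seq gT -> M).
Implicit Types f : cochain.

Definition translate g : {linear cochain -> cochain} :=
  pull M H (mulg (coset N g)) (mulg g).

Lemma translate_id A n t f h : A \subset H -> inv_fil A H n t f -> h \in A ->
  translate h f = f.
Proof.
move=> /subsetP sAH [f0 fi] hA; apply/funext => -[a b].
rewrite /= /pull_fun; case: ifP => [_|nc]; first exact: fi.
by apply/esym/eqP; apply: contraFT nc => /f0 /andP[].
Qed.

(** Translation of cochains is a right action, matching right multiplication of cosets in
    [equivariant_family]. *)
Lemma translate_comp g h f : g \in H -> h \in H ->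
  translate h (translate g f) = translate (g * h)%g f.
Proof.
move=> gH hH; rewrite /translate pull_comp; last exact: maps_cells_ltrans.
congr (pull M H _ _ f); apply/funext => x /=; last by rewrite mulgA.
by rewrite (coset_mulH nNH) // mulgA.
Qed.

Lemma translate_B A B k n t g f : g \in H -> B \subset H ->
  {in B, forall h, (g * h * g^-1)%g \in A} ->
  inv_B A H k n t f -> inv_B B H k n t (translate g f).
Proof.
move=> gH sBH gB; apply: (pull_B (maps_cells_ltrans _ gH) sBH gB).
exact: equivariant_sub sBH (equivariant_ltrans nNH gH).
Qed.

Lemma translate_fil A B n t g f : g \in H -> B \subset H ->
  {in B, forall h, (g * h * g^-1)%g \in A} ->
  inv_fil A H n t f -> inv_fil B H n t (translate g f).
Proof.
move=> gH sBH gB; apply: (pull_fil sBH gB).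
exact: equivariant_sub sBH (equivariant_ltrans nNH gH).
Qed.

Section EquivariantFamily.
Variables (A : {group gT}) (I : {set {set gT}}).
Hypotheses (sAH : A \subset H).
Hypothesis IA : forall c h, c \in I -> h \in A -> (c :* h)%g \in I.

Definition equivariant_family (F : {set gT} -> cochain) :=
  forall c h, c \in I -> h \in A -> translate h (F c) = F (c :* h)%g.

(** Invariance of the sum comes from reindexing along [c :* h]; of each summand only the support is
    controlled, hence [set0]. *)
Lemma family_fil n t F : equivariant_family F ->
  (forall c, c \in I -> inv_fil set0 H n t (F c)) ->
  inv_fil A H n t (\sum_(c in I) F c).
Proof.
move=> eF fF; have sum0 : inv_fil set0 H n t (\sum_(c in I) F c).
  apply: (big_ind (inv_fil set0 H n t)) => //; first exact: inv_fil0.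
  by move=> f g fF' gF'; rewrite -[f]scale1r; apply: inv_fil_lin.
split=> [|h a b hA]; first exact: sum0.1.
set f := \sum_(c in I) F c in sum0 *; have hH := subsetP sAH h hA.
have fh : translate h f = f.
  rewrite /f linear_sum /= [RHS](reindex_inj (@rcoset_inj _ h)) /=.
  rewrite [LHS](eq_bigr (fun c => F (c :* h)%g)) => [|c cI]; last exact: eF.
  apply: eq_bigl => c; apply/idP/idP => [cI|/IA/(_ (groupVr hA))]; first exact: IA.
  by rewrite rcosetK.
have := congr1 (@^~ (a, b)) fh; rewrite /= /pull_fun; case: ifP => // nc <-.
apply/eqP; apply: contraFT nc => /sum0.1/andP[].
by rewrite is_cell_act.
Qed.

Lemma family_Z k n t F : equivariant_family F ->
  (forall c, c \in I -> inv_Z set0 H k n t (F c)) ->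
  inv_Z A H k n t (\sum_(c in I) F c).
Proof.
move=> eF fF; split; first by apply: family_fil => // c /fF[].
rewrite linear_sum; apply: (family_fil (F := fun c => lhs_d H N M (F c))).
  move=> c h cI hA; rewrite -eF //; apply: pull_d.
    exact: maps_cells_ltrans (subsetP sAH h hA).
  by move=> s /(fF c cI).1.1/andP[].
by move=> c /fF[].
Qed.

(* The boundary of F c is found at one point of each A-orbit, and transported
   along the orbit. *)
Lemma family_B k n t F : equivariant_family F ->
  (forall c, c \in I -> inv_B [set h in A | (c :* h)%g == c] H k n t (F c)) ->
  inv_B A H k n t (\sum_(c in I) F c).
Proof.
move=> eF BF.
(* A chosen point of each [A]-orbit: the pick depends on the orbit only, and the default never
   occurs, as the orbit contains [c]. *)
pose rep (c : {set gT}) := odflt c [pick x in orbit 'Rs%act A c].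
have repP c : exists2 h, h \in A & c = (rep c :* h)%g.
  have : rep c \in orbit 'Rs%act A c.
    by rewrite /rep; case: pickP => //= _; apply: orbit_refl.
  by rewrite orbit_sym => /orbitP[h hA e]; exists h; rewrite // -rcosetE.
have rep_rc c h : h \in A -> rep (c :* h)%g = rep c.
  move=> hA; have e : orbit 'Rs%act A (c :* h)%g = orbit 'Rs%act A c.
    have : (c :* h)%g \in orbit 'Rs%act A c by rewrite -rcosetE; apply: mem_orbit.
    by move/orbit_eqP.
  rewrite /rep e; case: pickP => //= /(_ c); by rewrite orbit_refl.
have [s sP] : {s : {set gT} -> gT & forall c, s c \in A /\ c = (rep c :* s c)%g}.
  apply: (choice (P := fun c h => h \in A /\ c = (rep c :* h)%g)) => c.
  by have [h hA e] := repP c; exists h.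
have yw_ex c : exists yw : cochain * cochain, c \in I ->
    [/\ inv_Z [set h in A | (c :* h)%g == c] H k.-1 (n + 1) t yw.1,
        inv_Z [set h in A | (c :* h)%g == c] H k.-1 (n - k%:Z + 1) (t - 1) yw.2
      & F c = yw.1 + lhs_d H N M yw.2].
  case: (boolP (c \in I)) => [/BF[y [w ?]]|_]; last by exists (0, 0).
  by exists (y, w).
have [yw ywP] := choice yw_ex.
have repI c : c \in I -> rep c \in I.
  have [sA e] := sP c; rewrite {1}e => /IA/(_ (groupVr sA)).
  by rewrite rcosetK.
pose ext (u : {set gT} -> cochain) c := translate (s c) (u (rep c)).
have sH c : s c \in H by apply: (subsetP sAH); exact: (sP c).1.
have ext_fam u n' t' :
    (forall c, c \in I -> inv_fil [set h in A | (c :* h)%g == c] H n' t' (u c)) ->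
    equivariant_family (ext u).
  move=> uF c h cI hA; have hH := subsetP sAH h hA.
  rewrite /ext translate_comp // rep_rc //.
  (* [e] stabilizes [rep c], and [u (rep c)] is invariant under that stabilizer, so the transport
     does not depend on the choice of [s]. *)
  pose e := (s c * h * (s (c :* h))^-1)%g.
  have eA : e \in A by rewrite !(groupM, groupV) ?hA ?(sP _).1.
  have -> : (s c * h = e * s (c :* h))%g by rewrite /e mulgKV.
  rewrite -translate_comp ?(subsetP sAH) ?(sP _).1 //; congr (translate _ _).
  have uc := uF _ (repI _ cI).
  apply: translate_id uc _; first by apply/subsetP=> x; rewrite inE => /andP[/(subsetP sAH)].
  rewrite inE eA /e !rcosetM -(sP c).2 -{1}(rep_rc c h hA).
  by rewrite {1}(sP (c :* h)%g).2 rcosetK eqxx.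
have ext_Z u k' n' t' :
    (forall c, c \in I -> inv_Z [set h in A | (c :* h)%g == c] H k' n' t' (u c)) ->
    inv_Z A H k' n' t' (\sum_(c in I) ext u c).
  move=> uZ; apply: family_Z => [|c cI].
    by apply: (ext_fam u n' t') => c /uZ[].
  have [uF duF] := uZ _ (repI _ cI); rewrite /ext /translate.
  apply: (pull_Z (maps_cells_ltrans N (sH c)) (sub0set H) (A' := set0) (phi := id)).
  - by move=> h; rewrite inE.
  - by move=> h; rewrite inE.
  by split; [case: uF | case: duF] => ? _; split=> // h a b; rewrite inE.
exists (\sum_(c in I) ext (fun c => (yw c).1) c), (\sum_(c in I) ext (fun c => (yw c).2) c).
split; try by apply: ext_Z => c /ywP[].
rewrite linear_sum -big_split; apply: eq_bigr => c cI /=.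
have [sA e] := sP c; have [_ w2 eF'] := ywP _ (repI _ cI).
rewrite {1}e -eF ?repI // eF' linearD; congr (_ + _).
apply: pull_d; first exact: maps_cells_ltrans.
by move=> x /w2.1.1/andP[].
Qed.
End EquivariantFamily.
End Transfer.

(** * The transfer from [S] to [G] and its composite with restriction *)

Section TransferMap.
Variables (R : pzRingType) (gT : finGroupType) (M : lmodType R).
Variables (G K S T : {group gT}).
Hypotheses (nKG : (K <| G)%g) (sSG : S \subset G) (nTS : (T <| S)%g).
Hypotheses (SK_sub_T : S :&: K \subset T) (T_sub_K : T \subset K).

Local Notation cochain N := (seq (coset_of N) * seq gT -> M).
Local Notation I := (rcosets S G).

Lemma rcosets_closed c h : c \in I -> h \in G -> (c :* h)%g \in I.
Proof.
by move=> /rcosetsP[g gG ->] hG; apply/rcosetsP; exists (g * h)%g; rewrite ?groupM ?rcosetM.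
Qed.

Lemma rcosets_repr c : c \in I -> repr c \in G /\ c = (S :* repr c)%g.
Proof.
case/rcosetsP=> g gG ->; have gr := mem_repr_rcoset S g.
split; last by apply/esym/rcoset_eqP.
by case/rcosetP: gr => s sS ->; rewrite groupM // (subsetP sSG).
Qed.

Lemma rcoset_stab g h : ((S :* g :* h)%g == (S :* g)%g) = ((g * h * g^-1)%g \in S).
Proof.
rewrite -rcosetM -mem_rcoset; apply/eqP/idP => [<-|/rcoset_eqP //].
exact: rcoset_refl.
Qed.

(** [repr c * h] and the representative of [c :* h] differ by a left factor in [S], under which [v]
    is invariant. *)
Lemma translate_family n t (v : cochain K) : inv_fil S G n t v ->
  equivariant_family G G I (fun c => translate M G K (repr c) v).
Proof.
move=> vF c h cI hG; have [rG e] := rcosets_repr cI.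
have [rhG eh] := rcosets_repr (rcosets_closed cI hG).
rewrite translate_comp //.
have : (repr c * h)%g \in (S :* repr (c :* h)%g)%g.
  by rewrite -eh {2}e -rcosetM rcoset_refl.
case/rcosetP=> s sS ->; rewrite -translate_comp ?(subsetP sSG _ sS) //.
by rewrite (translate_id sSG vF sS).
Qed.

Definition transfer_fun (f : cochain T) : cochain K :=
  \sum_(c in I) translate M G K (repr c)
    (pull M G (retract_coset S (K := K) T) (retract S) f).

Lemma transfer_linear : linear transfer_fun.
Proof.
move=> a f g; rewrite /transfer_fun scaler_sumr -big_split; apply: eq_bigr => c _ /=.
by rewrite !linearP.
Qed.
HB.instance Definition _ :=
  GRing.isLinear.Build R (cochain T) (cochain K) _ transfer_fun transfer_linear.
Definition transfer_map : {linear cochain T -> cochain K} := transfer_fun.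

Let retr_cells := maps_cells_retract sSG nKG SK_sub_T.
Let retr_eqv := equivariant_retract sSG nKG nTS SK_sub_T.

Lemma retract_fil n t (f : cochain T) : inv_fil S S n t f ->
  inv_fil S G n t (pull M G (retract_coset S (K := K) T) (retract S) f).
Proof. exact: (pull_fil sSG (fun h hS => hS) retr_eqv). Qed.

Lemma transfer_fil n t f : f \in fc_fil (lhs_complex S T M) n t ->
  transfer_map f \in fc_fil (lhs_complex G K M) n t.
Proof.
move=> /lhs_filP fF; apply/lhs_filP.
have rF := retract_fil fF.
apply: (family_fil (subxx G) rcosets_closed (translate_family rF)) => c cI.
have [rG _] := rcosets_repr cI.
by apply: (translate_fil nKG rG (sub0set G) _ rF) => h; rewrite inE.
Qed.

Lemma transfer_d n t f : f \in fc_fil (lhs_complex S T M) n t ->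
  transfer_map (fc_d (lhs_complex S T M) f) = fc_d (lhs_complex G K M) (transfer_map f).
Proof.
move=> /lhs_filP fF; rewrite [RHS]linear_sum; apply: eq_bigr => c cI.
have [rG _] := rcosets_repr cI.
have rF := retract_fil fF.
have sF s : f s != 0 -> is_cell S s by move=> /fF.1/andP[].
rewrite /= -[lhs_d_fun S f]/(lhs_d S T M f) (pull_d retr_cells sF).
by apply: (pull_d (maps_cells_ltrans K rG)) => s /rF.1/andP[].
Qed.

Definition transfer : fc_morphism (lhs_complex S T M) (lhs_complex G K M) :=
  @FcMorphism _ (lhs_complex S T M) (lhs_complex G K M) transfer_map transfer_fil transfer_d.

Lemma idmS : (idm S @* S \subset G)%g. Proof. by rewrite morphim_idm. Qed.
Lemma idmT : (idm S @* T \subset K)%g.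
Proof. by rewrite morphim_idm ?(normal_sub nTS). Qed.

Definition res : fc_morphism (lhs_complex G K M) (lhs_complex S T M) :=
  pullback M nTS nKG idmS idmT.

Let res_cells := (coset_mapP nTS nKG idmS idmT).1.
Let res_eqv := (coset_mapP nTS nKG idmS idmT).2.

Lemma resE x : res x = pull M S (coset_map K (idm S)) (idm S) x.
Proof. by []. Qed.

(** Retraction followed by inclusion is an [S]-equivariant self-map of the cells of [G], so [v] is
    an [S]-invariant boundary. The difference is the sum of the translates of [v], to which
    [family_B] applies. *)
Lemma transfer_res k n t (x : cochain K) : (1 < k)%N -> inv_Z G G k n t x ->
  inv_B G G k n t (transfer (res x) - x *+ #|G : S|%g).
Proof.
move=> k1 xZ.
pose v := pull M G (retract_coset S (K := K) T) (retract S) (res x) - x.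
have xF := xZ.1.
have rF : inv_fil S S n t (res x).
  by have /lhs_filP := fm_fil res (introT (lhs_filP G n t x) xF).
have vB : inv_B S G k n t v.
  rewrite /v -{2}(pull_id xF) resE pull_comp //.
  apply: (pull_homotopic (phi := id) sSG _ _ _ _ _ k1 xZ).
  - by move=> h /(subsetP sSG).
  - by split.
  - exact: maps_cells_comp retr_cells res_cells.
  - by move=> h _; split.
  exact: equivariant_comp retr_cells (fun h hS => hS) retr_eqv res_eqv.
have -> : transfer (res x) - x *+ #|G : S|%g = \sum_(c in I) translate M G K (repr c) v.
  rewrite /indexg -sumr_const -sumrB; apply: eq_bigr => c cI.
  by rewrite linearB (translate_id (subxx G) xF (rcosets_repr cI).1).
have vF : inv_fil S G n t v.
  rewrite /v addrC -scaleN1r; apply: inv_fil_lin; last exact: retract_fil.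
  by split; [exact: xF.1 | move=> h a b /(subsetP sSG); exact: xF.2].
apply: (family_B nKG (subxx G) rcosets_closed (translate_family vF)) => c cI.
have [rG e] := rcosets_repr cI.
(* Conjugation by the representative carries the stabilizer of [c] into [S], so the translate of [v]
   is a boundary invariant under that stabilizer. *)
apply: (translate_B nKG rG _ _ vB); first by apply/subsetP=> h /setIdP[].
by move=> h; rewrite inE {1 2}e rcoset_stab => /andP[].
Qed.
End TransferMap.

(** * The double coset argument and the stability of restrictions *)

Section Mackey.
Variables (R : pzRingType) (gT : finGroupType) (M : lmodType R).
Variables (G K S : {group gT}).
Hypotheses (nKG : (K <| G)%g) (sSG : S \subset G).

(** This form of the intersection of [K] and [S] is the one that [extension_complex] produces for
    [S] itself. *)
Local Notation T := (S :&: (K :&: S))%G.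
Local Notation cochain N := (seq (coset_of N) * seq gT -> M).
Local Notation I := (rcosets S G).
Let scT := normal_strongly_closed S nKG.
Let nTS : (T <| S)%g := strongly_closed_norm sSG scT (subxx S).

Lemma SK_sub_T : S :&: K \subset T.
Proof. by apply/subsetP=> x; rewrite !inE => /andP[-> ->]. Qed.

Lemma T_sub_K : T \subset K.
Proof. by apply/subsetP=> x; rewrite !inE => /and3P[]. Qed.

Local Notation transfer := (transfer M nKG sSG nTS SK_sub_T).
Local Notation res := (res M nKG sSG nTS T_sub_K).
Local Notation rho := (retract_coset S (K := K) T).

Let res_cells := (coset_mapP nTS nKG (idmS sSG) (idmT nTS T_sub_K)).1.
Let res_eqv := (coset_mapP nTS nKG (idmS sSG) (idmT nTS T_sub_K)).2.
Let retr_cells := maps_cells_retract sSG nKG SK_sub_T.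
Let retr_eqv := equivariant_retract sSG nKG nTS SK_sub_T.

Definition stable_mod k n t (x : cochain T) :=
  forall phi : fusion_arrow G S, inv_B (fa_dom phi) (fa_dom phi) k n t
    (fusion_pullback M sSG scT phi x - inclusion_pullback M sSG scT phi x).

Lemma mackey_term k n t g (x : cochain T) : (1 < k)%N -> g \in G ->
  inv_Z S S k n t x -> stable_mod k n t x ->
  inv_B (S :&: S :^ g)%g S k n t
    (res (translate M G K g (pull M G rho (retract S) x)) - x).
Proof.
move=> k1 gG xZ st; pose P := (S :&: S :^ g)%G; rewrite -[(_ :&: _)%g]/(gval P).
have sPS : P \subset S by apply: subsetIl.
have PgS h : h \in P -> (g * h * g^-1)%g \in S.
  by case/setIP=> _; rewrite mem_conjg conjgE invgK mulgA.
pose TP := (P :&: (K :&: S))%G.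
have nTP : (TP <| P)%g := strongly_closed_norm sSG scT sPS.
have PT_TP : P :&: T \subset TP.
  by apply/subsetP=> y /setIP[yP /setIP[_ yT]]; apply/setIP.
(* Since [y ^ g] is g^-1 y g, conjugation by [g^-1] is the map y |-> g y g^-1. *)
have fus : fusion_hom G S (conjgm_morphism P g^-1).
  split; first by rewrite morphim_conj setIid sub_conjgV subsetIr.
  by exists g => // y _; rewrite /= /conjgm conjgE invgK mulgA.
pose fa := FusionArrow sPS fus; pose phi := fa_mor fa.
have stP : inv_B P P k n t (pull M P (coset_map T phi) phi x -
    pull M P (coset_map T (idm P)) (idm P) x) := st fa.
have [phi_cells phi_eqv] := coset_mapP nTP nTS fus.1 (fusion_arrow_T scT fa).
have [inc_cells inc_eqv] := coset_mapP nTP nTS (idm_S sPS) (idm_T (K :&: S) sPS).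
have tau_cells := maps_cells_retract sPS nTS PT_TP.
have tau_eqv := equivariant_retract sPS nTS nTP PT_TP.
have idP : {in P, forall h, h \in P} by [].
have tr_cells := maps_cells_ltrans K gG.
have tr_eqv := equivariant_ltrans nKG gG.
set al := retract_coset P TP in tau_cells tau_eqv.
rewrite resE /translate (pull_comp tr_cells) (pull_comp res_cells).
set y := pull M S _ _ x.
pose y1 := pull M S al (retract P) (pull M P (coset_map T phi) phi x).
pose y2 := pull M S al (retract P) (pull M P (coset_map T (idm P)) (idm P) x).
(* From [y] to [y1]: a homotopy of maps equivariant for conjugation by [g]. From [y1] to [y2]:
   stability of [x] along [fa], pulled back from the cells of [P] to those of [S] by the retraction.
   From [y2] to [x]: a homotopy for the identity. *)
rewrite -(subrKA y1) -[X in _ + X](subrKA y2); apply: inv_BD; last apply: inv_BD.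
- rewrite /y /y1 (pull_comp tau_cells).
  apply: (pull_homotopic (phi := fun h => (g * h * g^-1)%g) sPS PgS _ _ _ _ k1 xZ).
  + exact: maps_cells_comp tau_cells phi_cells.
  + by apply: maps_cells_comp res_cells _; apply: maps_cells_comp tr_cells retr_cells.
  + apply: (equivariant_eq (phi := phi \o id)).
      by move=> h _; rewrite /= /conjgm conjgE invgK mulgA.
    exact: equivariant_comp tau_cells idP tau_eqv phi_eqv.
  have sPG := subset_trans sPS sSG.
  have tr_retr := equivariant_comp tr_cells PgS (equivariant_sub sPG tr_eqv) retr_eqv.
  exact: equivariant_comp res_cells idP (equivariant_sub sPS res_eqv) tr_retr.
- rewrite /y1 /y2 -linearB; apply: (pull_B tau_cells sPS idP tau_eqv stP).
rewrite /y2 (pull_comp tau_cells) -{2}(pull_id xZ.1).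
apply: (pull_homotopic (phi := id) sPS _ _ _ _ _ k1 xZ).
- by move=> h /(subsetP sPS).
- by split.
- exact: maps_cells_comp tau_cells inc_cells.
- by move=> h _; split.
exact: equivariant_comp tau_cells idP tau_eqv inc_eqv.
Qed.

(** [S] permutes the cosets from the right, and the stabilizer of [c] is [S :&: S :^ repr c], the
    group for which [mackey_term] gives a boundary; [family_B] then plays the part of the double
    coset formula. *)
Lemma res_transfer k n t (x : cochain T) : (1 < k)%N ->
  inv_Z S S k n t x -> stable_mod k n t x ->
  inv_B S S k n t (res (transfer x) - x *+ #|G : S|%g).
Proof.
move=> k1 xZ st; have xF := xZ.1.
pose v : cochain K := pull M G rho (retract S) x.
have vF : inv_fil S G n t v := retract_fil nKG sSG nTS SK_sub_T xF.
have -> : res (transfer x) - x *+ #|G : S|%g =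
    \sum_(c in I) (res (translate M G K (repr c) v) - x).
  by rewrite linear_sum /indexg -sumr_const -sumrB.
apply: (family_B nTS (subxx S)) => [c h cI hS|c h cI hS|c cI].
- exact: rcosets_closed cI (subsetP sSG h hS).
- have hG := subsetP sSG h hS.
  rewrite linearB (translate_id (subxx S) xF hS); congr (_ - _).
  rewrite -(translate_family nKG sSG vF cI hG) !resE.
  rewrite /translate (pull_comp (maps_cells_ltrans T hS)) [RHS](pull_comp res_cells).
  by apply: eq_pull => y yS /=; rewrite ?(res_eqv hS).1.
have [rG e] := rcosets_repr sSG cI.
have -> : [set h in S | (c :* h)%g == c] = (S :&: S :^ repr c)%g.
  apply/setP=> h; rewrite !inE; congr (_ && _).
  by rewrite e rcoset_stab -e mem_conjg conjgE invgK mulgA.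
exact: mackey_term.
Qed.

(** A [G]-invariant cochain is fixed by left translation by [g], so its pullback along y |-> g y
    g^-1 equals that along y |-> y g^-1. The latter map commutes with left multiplication by [P],
    hence is homotopic to the inclusion. *)
Lemma res_stable k n t (x : cochain K) : (1 < k)%N -> inv_Z G G k n t x ->
  stable_mod k n t (res x).
Proof.
move=> k1 xZ fa; pose P := fa_dom fa; pose phi := fa_mor fa.
have sPS : P \subset S := fa_dom_sub fa.
have sPG := subset_trans sPS sSG.
have [sphi [g gG phiE]] := fa_fusion fa.
pose TP := (P :&: (K :&: S))%G.
have nTP : (TP <| P)%g := strongly_closed_norm sSG scT sPS.
have [phi_cells _] := coset_mapP nTP nTS sphi (fusion_arrow_T scT fa).
have [inc_cells inc_eqv] := coset_mapP nTP nTS (idm_S sPS) (idm_T (K :&: S) sPS).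
have giG := groupVr gG.
have ltr_cells := maps_cells_ltrans K gG.
have rtr_cells := maps_cells_rtrans K giG.
have rtr_eqv := equivariant_rtrans K (g^-1)%g (H := G).
have SG_in : {in S, forall h, h \in G} by move=> h /(subsetP sSG).
have PS_in : {in P, forall h, h \in S} by move=> h /(subsetP sPS).
have iota_cells := maps_cells_comp inc_cells res_cells.
have iota_eqv := equivariant_comp inc_cells PS_in inc_eqv res_eqv.
rewrite -[fusion_pullback M sSG scT fa (res x)]/
  (pull M P (coset_map T phi) phi (pull M S (coset_map K (idm S)) (idm S) x)).
rewrite -[inclusion_pullback M sSG scT fa (res x)]/
  (pull M P (coset_map T (idm P)) (idm P) (pull M S (coset_map K (idm S)) (idm S) x)).
rewrite (pull_comp phi_cells) (pull_comp inc_cells).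
set iota := coset_map K (idm S) \o coset_map T (idm P).
have -> : pull M P (coset_map K (idm S) \o coset_map T phi) (idm S \o phi) x =
    pull M P (mulg^~ (coset K g^-1) \o iota) (mulg^~ g^-1%g \o (idm S \o idm P)) x.
  have iotaE := pull_comp (maps_cells_comp iota_cells rtr_cells)
    (mulg (coset K g)) (mulg g) x.
  rewrite -[in RHS](translate_id (subxx G) xZ.1 gG) iotaE.
  apply: eq_pull => [c /morphimP[y _ yP ->]|y yP] /=; last by rewrite phiE // mulgA.
  have yS := subsetP sPS y yP; have yG := subsetP sPG y yP.
  have phiyS : phi y \in S by apply: phi_in sphi _ yP.
  rewrite /= (coset_map_coset nTP nTS sphi (fusion_arrow_T scT fa) yP).
  rewrite /iota /= (coset_map_coset nTP nTS (idm_S sPS) (idm_T (K :&: S) sPS) yP).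
  rewrite !(coset_map_coset nTS nKG (idmS sSG) (idmT nTS T_sub_K)) //= phiE //.
  by rewrite !(coset_mulH nKG) ?groupM // mulgA.
apply: (pull_homotopic (phi := id) (subxx P) _ _ _ _ _ k1 xZ).
- by move=> h /(subsetP sPG).
- exact: iota_cells.
- exact: maps_cells_comp iota_cells rtr_cells.
- exact: iota_eqv.
exact: equivariant_comp iota_cells (fun h hP => subsetP sPG h hP) iota_eqv rtr_eqv.
Qed.

End Mackey.

(** * Induced maps and scalars on pages, computed on representatives *)

Section FcMorphismPages.
Variables (R : pzRingType) (C D : filtered_complex R) (h : fc_morphism C D).

Lemma fm_page_class k n m x : x \in fc_Z C k n (n + m) ->
  fm_page h k n m (sqclass _ _ x) = sqclass _ _ (h x).
Proof. by move=> xZ; rewrite /= sqmapE. Qed.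

Lemma fm_page_next k n m z u : fc_next z u ->
  fc_next (fm_page h k n m z) (fm_page h k.+1 n m u).
Proof.
move=> [x [xZ -> ->]]; exists (h x); split; first exact: fm_Z.
  by rewrite fm_page_class // fc_Z_succ.
by rewrite fm_page_class.
Qed.

End FcMorphismPages.

Section PageClasses.
Variables (R : pzRingType) (C : filtered_complex R).

Lemma sqclassZ k n t c (x : fc_mod C) : x \in fc_Z C k n t ->
  sqclass (fc_Z C k n t) (fc_B C k n t) (c *: x) = c *: sqclass _ _ x.
Proof.
move=> xZ; rewrite -[c *: x]addr0 sqclassP ?rpred0 //.
by rewrite (sqclass0 _ (rpred0 _)).2 ?addr0 ?rpred0.
Qed.

Lemma fc_nextZ k n m c (z : fc_page C k n m) u :
  fc_next z u -> fc_next (c *: z) (c *: u).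
Proof.
move=> [x [xZ -> ->]]; exists (c *: x); split; first exact: rpredZ.
  by rewrite sqclassZ // fc_Z_succ.
by rewrite sqclassZ.
Qed.
End PageClasses.

(** * From identities modulo boundaries to an isomorphism with the equalizer *)

Section EqualizerIso.
Variables (R : comNzRingType) (C D : filtered_complex R) (I : Type).
Variables (E : I -> filtered_complex R) (f g : forall i, fc_morphism D (E i)).
Variables (res : fc_morphism C D) (tr : fc_morphism D C) (q : nat) (u : R).
Hypothesis uV : u * q%:R = 1.
Hypothesis res_eq : forall k n t x i, (1 < k)%N -> x \in fc_Z C k n t ->
  f i (res x) - g i (res x) \in fc_B (E i) k n t.
Hypothesis tr_res : forall k n t x, (1 < k)%N -> x \in fc_Z C k n t ->
  tr (res x) - x *+ q \in fc_B C k n t.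
Hypothesis res_tr : forall k n t x, (1 < k)%N -> x \in fc_Z D k n t ->
  (forall i, f i x - g i x \in fc_B (E i) k n t) ->
  res (tr x) - x *+ q \in fc_B D k n t.

Local Notation EC := (fc_ss C).
Local Notation ED := (eq_ss f g).

(* The image of res is in the equalizer only from the second page on; res is
   replaced by 0 on the other pages. *)
Let trunc k : R := (1 < k)%N%:R.

Lemma res_page_eq k n m (z : fc_page C k n m) :
  trunc k *: fm_page res k n m z \in eq_pred f g (k:=k) (n:=n) (m:=m).
Proof.
rewrite /trunc; case: ltnP => [k1|_]; last by rewrite scale0r rpred0.
rewrite scale1r; apply/eq_predP => i.
have [x xZ ->] := sqclass_surj z.
rewrite !fm_page_class ?fm_Z //; apply/sqclassE; rewrite ?fm_Z //.
exact: res_eq.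
Qed.

Definition res_page k n m (z : fc_page C k n m) : eq_page f g k n m :=
  Sub (trunc k *: fm_page res k n m z) (res_page_eq z).

Lemma res_page_linear k n m : linear (@res_page k n m).
Proof.
move=> c x y; apply: val_inj.
by rewrite [RHS]linearP /= linearP scalerDr !scalerA mulrC.
Qed.
HB.instance Definition _ k n m := GRing.isLinear.Build R
  (fc_page C k n m) (eq_page f g k n m) _ (@res_page k n m) (@res_page_linear k n m).

Lemma res_pageE k n m (z : fc_page C k n m) : (1 < k)%N ->
  val (res_page z) = fm_page res k n m z.
Proof. by move=> k1; rewrite SubK /trunc k1 scale1r. Qed.

(** The factor [u], inverse to the index [q], makes this the two-sided inverse of [res_page] from
    the second page on. *)
Definition tr_page k n m (z : eq_page f g k n m) : fc_page C k n m :=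
  u *: fm_page tr k n m (val z).

Lemma tr_page_linear k n m : linear (@tr_page k n m).
Proof.
move=> c x y; rewrite /tr_page [val _]linearP linearP.
by rewrite scalerDr !scalerA mulrC.
Qed.
HB.instance Definition _ k n m := GRing.isLinear.Build R
  (eq_page f g k n m) (fc_page C k n m) _ (@tr_page k n m) (@tr_page_linear k n m).

Lemma scale_index (V : lmodType R) (x : V) : u *: (x *+ q) = x.
Proof. by rewrite -scaler_nat scalerA uV scale1r. Qed.

Lemma tr_res_page k n m (z : fc_page C k n m) : (1 < k)%N ->
  fm_page tr k n m (fm_page res k n m z) = z *+ q.
Proof.
move=> k1; have [x xZ ->] := sqclass_surj z.
rewrite !fm_page_class ?fm_Z // -!scaler_nat -sqclassZ //.
by apply/sqclassE; rewrite ?rpredZ ?fm_Z // scaler_nat tr_res.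
Qed.

(** Membership of [z] in the equalizer supplies, through a representative, the stability premise of
    [res_tr]. *)
Lemma res_tr_page k n m (z : eq_page f g k n m) : (1 < k)%N ->
  fm_page res k n m (fm_page tr k n m (val z)) = val z *+ q.
Proof.
move=> k1; have [x xZ zx] := sqclass_surj (val z); have /eq_predP st := valP z.
rewrite zx !fm_page_class ?fm_Z // -!scaler_nat -sqclassZ //.
apply/sqclassE; rewrite ?rpredZ ?fm_Z // scaler_nat res_tr // => i.
by have := st i; rewrite zx !fm_page_class // => /sqclassE; apply; rewrite fm_Z.
Qed.

Lemma eq_ss_iso : ss_isomorphic EC ED.
Proof.
exists (fun k n m => @res_page k n m), (fun k n m => @tr_page k n m).
split=> k n m k2.
- split=> [z|z w zw].
    by apply: val_inj; rewrite [LHS]res_pageE // fm_page_d -res_pageE.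
  rewrite -[ss_next _ _]/(fc_next (val (res_page z)) (val (res_page w))).
  by rewrite (res_pageE _ k2) (res_pageE _ (leqW k2)); apply: fm_page_next.
- split=> [z|z w zw].
    rewrite -[LHS]/(u *: fm_page tr _ _ _ (fc_diff D k n m (val z))).
    by rewrite fm_page_d -linearZ.
  by apply: fc_nextZ; apply: fm_page_next.
split=> z.
  rewrite -[LHS]/(u *: fm_page tr k n m (val (res_page z))).
  by rewrite res_pageE // tr_res_page // scale_index.
apply: val_inj; rewrite [LHS]res_pageE //= /tr_page linearZ /=.
rewrite -[X in _ *: X]/(fm_page res k n m (fm_page tr k n m (val z))).
by rewrite res_tr_page // scale_index.
Qed.
End EqualizerIso.

(** * The isomorphism for an invertible index, and the case of Z_(p) *)

Lemma stable_ss_iso (R : comNzRingType) (gT : finGroupType) (M : lmodType R)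
    (G K S : {group gT}) (u : R) (nKG : (K <| G)%g) (sSG : S \subset G) :
  u * #|G : S|%g%:R = 1 ->
  ss_isomorphic (lhs_ss G K M)
    (stable_ss M sSG (normal_strongly_closed S nKG)).
Proof.
move=> uV; have nTS := strongly_closed_norm sSG (normal_strongly_closed S nKG) (subxx S).
apply: (@eq_ss_iso _ _ _ _ _ _ _ (res M nKG sSG nTS (@T_sub_K _ K S))
  (transfer M nKG sSG nTS (@SK_sub_T _ K S)) _ _ uV) => k n t x.
- by move=> fa k1 /lhs_fc_Z xZ; apply/lhs_fc_B; apply: res_stable.
- by move=> k1 /lhs_fc_Z xZ; apply/lhs_fc_B; apply: transfer_res.
move=> k1 /lhs_fc_Z xZ st; apply/lhs_fc_B; apply: res_transfer => //.
by move=> fa; apply/lhs_fc_B; apply: st.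
Qed.

Lemma Zloc_nat_inv p n : (1 < p)%N -> coprime p n ->
  exists u : Zloc p, u * n%:R = 1.
Proof.
move=> p1 cop; have n0 : (n != 0)%N.
  by apply: contraTneq cop => ->; rewrite /coprime gcdn0 neq_ltn p1 orbT.
have inZ : (n%:Q)^-1 \in Zloc_pred p.
  (* In lowest terms 1/n has denominator n, which is coprime to [p]. *)
  by rewrite unfold_in -[_^-1]mul1r (@coprimeq_den 1) ?coprime1n // eqz_nat (negPf n0).
exists (exist [in Zloc_pred p] _ inZ); apply: val_inj.
by rewrite rmorphM rmorph_nat rmorph1 /= mulVf // pnatr_eq0.
Qed.

Theorem theorem5p1 (gT : finGroupType) (p : nat) (G K S : {group gT})
    (M : lmodType (Zloc p)) (p_pr : prime p) (nKG : (K <| G)%g)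
    (sylS : (p.-Sylow(G) S)%g) :
  ss_isomorphic (lhs_ss G K M)
    (stable_ss M (pHall_sub sylS) (normal_strongly_closed S nKG)).
Proof.
have [|u uV] := @Zloc_nat_inv p #|G : S|%g (prime_gt1 p_pr); last exact: stable_ss_iso uV.
(* The last component of the Sylow condition says that the index is prime to [p]. *)
have /and3P[_ _] := sylS.
by rewrite p'natE // prime_coprime.
Qed.
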